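(* Let $T^+=(T^+(s))_{s\in[0,t]}$ be the telegraph meander on $[0,t]$, $t>0$, with parameters $\lambda>0$, $c>0$. Then the absolutely continuous component of the law of $T^+(t)$ has density $$q_{\lambda,c}(x,t)=\frac{\mathsf{1}_{[0,ct)}(x)}{I_0(\lambda t)+I_1(\lambda t)}\left\{\frac{\lambda x\, I_0\big(\frac{\lambda}{c}\sqrt{c^2t^2-x^2}\big)}{c(ct+x)}+\frac{I_1\big(\frac{\lambda}{c}\sqrt{c^2t^2-x^2}\big)}{\sqrt{c^2t^2-x^2}}\Big(\frac{\lambda x}{c}+\frac{ct-x}{ct+x}\Big)\right\}.$$
   Context: Let $N$ be a homogeneous Poisson process of rate $\lambda>0$, and let $V(0)$ be independent of $N$ and uniformly distributed on $\{-c,c\}$, $c>0$. Set $V(s)=V(0)(-1)^{N(s)}$ and $T(s)=\int_0^sV(u)\,du$ (telegraph process). The telegraph meander $T^+$ on $[0,t]$ is the random continuous function on $[0,t]$ whose law is that of $(T(s))_{0\le s\le t}$ conditioned on $\{\min_{0\le s\le t}T(s)\ge0\}$; in particular $\mathsf{P}\{T^+(t)\in A\}=\mathsf{P}\{T(t)\in A\mid \min_{0\le s\le t}T(s)\ge0\}$ for Borel $A$. $I_\nu(x)=\sum_{k\ge0}(x/2)^{2k+\nu}\frac{1}{k!\,\Gamma(\nu+k+1)}$ is the modified Bessel function of the first kind. *)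

(* Defs.v *)
From HB Require Import structures.
From mathcomp Require Import all_boot all_order all_algebra.
From mathcomp Require Import all_classical all_reals all_analysis.

Set Implicit Arguments.
Unset Strict Implicit.
Unset Printing Implicit Defensive.

Import Order.TTheory GRing.Theory Num.Theory.
Import numFieldNormedType.Exports.

Local Open Scope classical_set_scope.
Local Open Scope ring_scope.

Definition Gamma (R : realType) (z : R) : R :=
  \int[lebesgue_measure]_(x in `]0, +oo[) (x `^ (z - 1) * expR (- x)).

(* Natural order only, so that [(x / 2) ^+ _] and [Gamma] are meaningful for
   every real argument. *)
Definition bessel_I (R : realType) (nu : nat) (x : R) : R :=
  limn (series (fun k : nat =>
    (x / 2) ^+ (2 * k + nu) / (k`!%:R * Gamma (nu%:R + k%:R + 1)))).

(* Taking some [B i] to be [setT] gives the product rule for subfamilies. *)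
Definition mutually_independent d (Omega : measurableType d) (R : realType)
    (P : probability Omega R) d' (U : measurableType d') (n : nat)
    (X : 'I_n -> Omega -> U) : Prop :=
  forall B : 'I_n -> set U, (forall i, measurable (B i)) ->
    P (\bigcap_i (X i @^-1` B i)) = (\prod_(i < n) P (X i @^-1` B i))%E.

Definition cond_prob d (Omega : measurableType d) (R : realType)
    (P : probability Omega R) (A M : set Omega) : \bar R :=
  (fine (P (A `&` M)) / fine (P M))%:E.

(* Truncated subtraction is harmless on nondecreasing paths. *)
Definition increment (R : realType) (Omega : Type) (N : R -> Omega -> nat)
    (s u : R) (w : Omega) : nat :=
  (N u w - N s w)%N.

(* Processes with index set [0, +oo[ (or [0, t]) are families indexed by all
   of [R]; indices outside that set are never constrained nor used. *)
Record is_poisson_process d (Omega : measurableType d) (R : realType)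
    (P : probability Omega R) (lambda : R) (N : R -> {RV P >-> nat}) : Prop := {
  poisson_process_start : forall w, N 0 w = 0%N;
  poisson_process_nondecreasing : forall w (s u : R), 0 <= s -> s <= u ->
    (N s w <= N u w)%N;
  poisson_process_right_continuous : forall w (s : R), 0 <= s ->
    \forall u \near s^'+, N u w = N s w;
  poisson_process_independent_increments :
    forall (n : nat) (s : nat -> R), 0 <= s 0%N ->
      {homo s : i j / (i <= j)%N >-> i <= j} ->
      mutually_independent P
        (fun i : 'I_n => increment (fun r => N r : Omega -> nat) (s i) (s i.+1));
  poisson_process_increment_law : forall (s u : R) (k : nat), 0 <= s -> s < u ->
    P [set w | increment (fun r => N r : Omega -> nat) s u w = k] =
      (poisson_pmf (lambda * (u - s)) k)%:E
}.

Definition process_sigma_algebra (Omega : Type) (R : realType)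
    (N : R -> Omega -> nat) : set (set Omega) :=
  <<s [set E | exists (s : R) (B : set nat), 0 <= s /\ E = N s @^-1` B] >>.

Definition independent_of_process d (Omega : measurableType d) (R : realType)
    (P : probability Omega R) (Y : {RV P >-> R}) (N : R -> {RV P >-> nat}) :
    Prop :=
  forall (B : set R) (E : set Omega), measurable B ->
    process_sigma_algebra (fun s => N s : Omega -> nat) E ->
    P (Y @^-1` B `&` E) = (P (Y @^-1` B) * P E)%E.

Definition uniform_on_pm d (Omega : measurableType d) (R : realType)
    (P : probability Omega R) (c : R) (Y : {RV P >-> R}) : Prop :=
  P (Y @^-1` [set c]) = (2^-1)%:E /\ P (Y @^-1` [set - c]) = (2^-1)%:E.

Section telegraph.
Context (R : realType) (Omega : Type).

Definition telegraph_velocity (V0 : Omega -> R) (N : R -> Omega -> nat)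
    (s : R) (w : Omega) : R :=
  V0 w * (- 1) ^+ N s w.

Definition telegraph (V0 : Omega -> R) (N : R -> Omega -> nat)
    (s : R) (w : Omega) : R :=
  \int[lebesgue_measure]_(u in `[0, s]) telegraph_velocity V0 N u w.

End telegraph.

(* The infimum is attained when [f] is continuous on [0, t]. *)
Definition path_min (R : realType) (t : R) (f : R -> R) : R :=
  inf [set f s | s in (`[0, t] : set R)].

(* The sigma-algebra generated by the evaluations at the times in [0, t]; its
   trace on the continuous paths is the Borel sigma-algebra of C([0, t]). *)
Definition path_sigma_algebra (R : realType) (t : R) : set (set (R -> R)) :=
  <<s [set F | exists (s : R) (A : set R),
         [/\ 0 <= s, s <= t, measurable A & F = [set f : R -> R | A (f s)]]] >>.

(* [X] may live on a probability space other than that of [V0] and [N]: only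
   the law of its path on [0, t] is prescribed. *)
Record is_telegraph_meander d (Omega : measurableType d) d'
    (Omega' : measurableType d') (R : realType)
    (P : probability Omega R) (V0 : {RV P >-> R}) (N : R -> {RV P >-> nat})
    (P' : probability Omega' R) (t : R) (X : R -> {RV P' >-> R}) : Prop := {
  meander_continuous : forall w, {within `[0, t], continuous (fun s : R => X s w)};
  meander_law : forall F : set (R -> R), path_sigma_algebra t F ->
    let path := fun (w : Omega) (s : R) => telegraph V0 (fun r => N r : Omega -> nat) s w in
    P' [set w | F (fun s : R => X s w)] =
      cond_prob P [set w | F (path w)] [set w | 0 <= path_min t (path w)]
}.

Definition mutually_singular d (S : measurableType d) (R : realType)
    (mu nu : set S -> \bar R) : Prop :=
  exists2 A, measurable A & mu A = 0%E /\ nu (~` A) = 0%E.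

Definition is_lebesgue_decomposition d (S : measurableType d) (R : realType)
    (mu nu : set S -> \bar R) (mu_ac mu_s : {measure set S -> \bar R}) : Prop :=
  [/\ mu_ac `<< nu, mutually_singular mu_s nu &
      forall A, measurable A -> mu A = (mu_ac A + mu_s A)%E].

(* [f] is a density of the absolutely continuous component of [mu] with respect
   to Lebesgue measure; the decomposition of a finite measure is unique. *)
Definition ac_component_density (R : realType)
    (mu : {measure set R -> \bar R}) (f : R -> R) : Prop :=
  [/\ measurable_fun [set: R] f, forall x, 0 <= f x &
      exists mu_ac mu_s : {measure set R -> \bar R},
        is_lebesgue_decomposition mu lebesgue_measure mu_ac mu_s /\
        forall A, measurable A ->
          mu_ac A = (\int[lebesgue_measure]_(x in A) (f x)%:E)%E].

Definition telegraph_meander_density (R : realType) (lambda c t x : R) : R :=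
  let r := Num.sqrt (c ^+ 2 * t ^+ 2 - x ^+ 2) in
  \1_(`[0, c * t[ : set R) x /
    (bessel_I 0 (lambda * t) + bessel_I 1 (lambda * t)) *
  (lambda * x * bessel_I 0 (lambda / c * r) / (c * (c * t + x)) +
   bessel_I 1 (lambda / c * r) / r *
     (lambda * x / c + (c * t - x) / (c * t + x))).

(* Main.v *)
Require Import Defs.
From HB Require Import structures.
From mathcomp Require Import all_boot all_order all_algebra.
From mathcomp Require Import all_classical all_reals all_analysis.
From mathcomp Require Import measurable_realfun ring lra.

Set Implicit Arguments.
Unset Strict Implicit.
Unset Printing Implicit Defensive.

Import Order.TTheory GRing.Theory Num.Theory.
Import numFieldNormedType.Exports.

Local Open Scope classical_set_scope.
Local Open Scope ring_scope.

(** On {V0 = c} one has T = c S with S(s) the integral of (-1)^N over [0, s].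
    Put u = (s + x)/2 and v = (s - x)/2 (time spent going up, going down).  Then
    P(N(s) = n, S >= 0 on [0, s], S(s) >= x)
      = e^(-lambda s) lambda^n u^a v^b / (a! b!),  a = floor(n/2), b = ceil(n/2).
    Indeed, over a short time h the number of jumps is 0, 1 or (with probability
    O(h^2)) more; without jump the particle moves along a characteristic, and the
    constraint S >= 0 is either preserved (going up) or amounts to a constraint
    on the final position (going down).  So both sides satisfy, along
    characteristics, the same difference equation up to O(h^2), and therefore
    agree.  Summing over n gives the tail of the law of T+(t): the term n = 0 is
    the atom at ct, and differentiating the other terms in x gives the density
    as a power series, which is recognized as a combination of I_0 and I_1. *)

(** * The integrated telegraph signal of a counting path *)

(** Nothing is known beforehand about the regularity of the survival probabilities, so no
    differential equation is written. The passage from s to s + h is kept as a two-sided bound with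
    error O(h^2), and summing over a mesh of size T/m leaves O(1/m). The induction on n then needs a
    starting value on each characteristic. For odd n the lines s + x = const start on the diagonal x
    = s, where the probability is 0. For even n the lines s - x = const start on the axis x = 0,
    where the value is unknown and solves an equation of its own. A second obstacle is that
    independence is assumed only for finitely many increments of N, while survival constrains the
    whole path. Survival events are therefore written as decreasing limits of events read on dyadic
    grids. A negative initial velocity makes the path negative at once, so up to a null event the
    conditioning forces V0 = c. The factor 1/2 cancels, and so does e^(-lambda t). The normalizing
    constant I_0(lambda t) + I_1(lambda t) is the survival series at x = 0, and the atom at ct has
    the inverse of it as mass. *)

Section unit_telegraph.
Context (R : realType) (m : R -> nat).
Hypothesis m_nd : forall s u : R, 0 <= s -> s <= u -> (m s <= m u)%N.

Definition unit_telegraph (s : R) : R :=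
  \int[lebesgue_measure]_(u in `[0, s]) ((- 1) ^+ m u : R).

Local Notation S := unit_telegraph.

(** By monotonicity each of the countably many level sets is an interval. *)
Lemma measurable_nondecreasing_nat s : measurable_fun (`[0, s] : set R) m.
Proof.
move=> mD B mB.
have -> : `[0, s]%classic `&` m @^-1` B =
    \bigcup_(k in B) (`[0, s]%classic `&` m @^-1` [set k]).
  apply/seteqP; split=> [u [Du Bu]|u [k Bk [Du /= mk]]]; first by exists (m u).
  by split => //=; rewrite mk.
apply: bigcup_measurable => k _; apply: is_interval_measurable.
move=> x y [/=]; rewrite !in_itv /= => /andP[x0 xs] mx [/andP[y0 ys] my] z /andP[xz zy].
split; first by rewrite in_itv/= (le_trans x0 xz) (le_trans zy ys).
apply/eqP; rewrite eqn_leq -{1}my -[X in (X <= _)%N && _]/(m z) m_nd//= ?(le_trans x0)//.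
by rewrite -mx m_nd.
Qed.

Lemma unit_telegraph_integrable s :
  lebesgue_measure.-integrable `[0, s] (EFin \o (fun u => (- 1) ^+ m u : R)).
Proof.
apply: measurable_bounded_integrable => //.
- by rewrite /= lebesgue_measure_itv/=; case: ifPn => // _; rewrite -EFinB ltry.
- apply: (@measurableT_comp _ _ _ _ _ _ (fun k : nat => (-1) ^+ k : R)) => //.
  exact: measurable_nondecreasing_nat.
- exists 1; split => // M M1 x /= _.
  by rewrite normrX normrN normr1 expr1n ltW.
Qed.

Lemma unit_telegraph0 : S 0 = 0.
Proof. by rewrite /S set_itv1 Rintegral_set1. Qed.

Lemma unit_telegraphB a b : 0 <= a -> a <= b ->
  S b - S a = \int[lebesgue_measure]_(u in `]a, b]) ((- 1) ^+ m u : R).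
Proof.
by move=> a0 ab; rewrite /S Rintegral_itvB ?bnd_simp//; exact: unit_telegraph_integrable.
Qed.

Lemma lebesgue_fine_oc (a b : R) : a <= b ->
  fine (lebesgue_measure `]a, b]%classic) = b - a.
Proof.
rewrite lebesgue_measure_itv/= lte_fin.
by case: ltgtP => //= -> _; rewrite subrr.
Qed.

Lemma unit_telegraph_lipschitz a b : 0 <= a -> a <= b -> `|S b - S a| <= b - a.
Proof.
move=> a0 ab; rewrite unit_telegraphB//.
have iS : lebesgue_measure.-integrable `]a, b] (EFin \o (fun u => (- 1) ^+ m u : R)).
  apply: integrableS (unit_telegraph_integrable b) => //.
  by apply: subset_itvr; rewrite bnd_simp.
apply: (le_trans (le_normr_Rintegral _ iS)) => //.
rewrite (_ : (fun t => _) = fun=> 1); last first.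
  by apply/funext => u; rewrite normrX normrN normr1 expr1n.
by rewrite Rintegral_cst// mul1r lebesgue_fine_oc.
Qed.

Lemma unit_telegraph_cst a b : 0 <= a -> a <= b -> m a = m b ->
  S b = S a + (- 1) ^+ m a * (b - a).
Proof.
move=> a0 ab mab; apply/eqP; rewrite addrC -subr_eq unit_telegraphB//; apply/eqP.
rewrite (@eq_Rintegral _ _ _ _ _ (fun=> (- 1) ^+ m a)); last first.
  move=> u; rewrite inE/= in_itv/= => /andP[au ub].
  congr (_ ^+ _); apply/eqP; rewrite eqn_leq {1}mab !m_nd ?(ltW au)//.
  exact: le_trans a0 (ltW au).
by rewrite Rintegral_cst// lebesgue_fine_oc.
Qed.

(** The left Riemann sum of the signal; it depends only on the counts at grid times, which gives
    access to measurability and to finite families of increments. *)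
Definition riemann_telegraph (h : R) (M : nat) : R :=
  \sum_(i < M) h * (- 1) ^+ m (i%:R * h).

(** The sum is exact on a cell without jump. On a cell with jumps the error is at most 2h, hence at
    most 2h times the number of jumps there, and these numbers telescope. *)
Lemma riemann_telegraph_error h M : 0 <= h ->
  `|S (M%:R * h) - riemann_telegraph h M| <= 2 * h * (m (M%:R * h))%:R.
Proof.
move=> h0; elim: M => [|M IH].
  by rewrite mul0r unit_telegraph0 /riemann_telegraph big_ord0 subrr normr0 !mulr_ge0.
rewrite /riemann_telegraph big_ord_recr/= -/(riemann_telegraph h M).
set a := M%:R * h in IH *; set b := M.+1%:R * h.
have a0 : 0 <= a by rewrite mulr_ge0.
have bE : b = a + h by rewrite /b -natr1 mulrDl mul1r.
have ab : a <= b by rewrite bE lerDl.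
have mab := m_nd a0 ab.
have step : `|S b - S a - h * (- 1) ^+ m a| <= 2 * h * ((m b)%:R - (m a)%:R).
  have := mab; rewrite leq_eqVlt => /predU1P[/eqP|] mE.
    move/eqP: mE => mE.
    rewrite (unit_telegraph_cst a0 ab mE) mE subrr mulr0.
    have -> : b - a = h by rewrite bE addrC addKr.
    have -> : S a + (-1) ^+ m b * h - S a - h * (-1) ^+ m b = 0 by ring.
    by rewrite normr0.
  have l1 := unit_telegraph_lipschitz a0 ab.
  have l2 : `|h * (-1) ^+ m a| = h.
    by rewrite normrM normrX normrN normr1 expr1n mulr1 ger0_norm.
  apply: (le_trans (ler_normB _ _)); rewrite l2.
  have : 1 <= (m b)%:R - (m a)%:R :> R by rewrite -natrB// ler1n subn_gt0.
  rewrite bE in l1 *; nra.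
have -> : S b - (riemann_telegraph h M + h * (- 1) ^+ m a) =
  (S a - riemann_telegraph h M) + (S b - S a - h * (- 1) ^+ m a) by ring.
apply: (le_trans (ler_normD _ _)); apply: (le_trans (lerD IH step)).
by rewrite mulrBr addrCA subrr addr0.
Qed.

End unit_telegraph.

(** * The difference equation along characteristics *)

Section forward_difference.
Context (R : realType).

(** On a mesh of size T/m the two functions drift apart by at most 2A(T/m)^2 per step, so by 2AT^2/m
    at time T. The common slope [f] only has to cancel. *)
Lemma forward_difference_unique (g phi f : R -> R) (T A : R) :
  0 <= T -> g 0 = phi 0 ->
  (forall a h : R, 0 <= a -> 0 <= h -> a + h <= T ->
     `|g (a + h) - g a - h * f a| <= A * h ^+ 2) ->
  (forall a h : R, 0 <= a -> 0 <= h -> a + h <= T ->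
     `|phi (a + h) - phi a - h * f a| <= A * h ^+ 2) ->
  g T = phi T.
Proof.
move=> T0 g0 Hg Hphi; apply/eqP; rewrite -subr_eq0 -normr_le0.
have key (m : nat) : `|g T - phi T| <= 2 * A * T ^+ 2 / m.+1%:R.
  pose h := T / m.+1%:R.
  have h0 : 0 <= h by rewrite divr_ge0.
  have hT : m.+1%:R * h = T by rewrite mulrC divfK.
  have step i : (i <= m.+1)%N ->
      `|g (i%:R * h) - phi (i%:R * h)| <= i%:R * (2 * A * h ^+ 2).
    elim: i => [_|i IH im]; first by rewrite !mul0r g0 subrr normr0.
    have {}IH := IH (ltnW im).
    have ia : 0 <= i%:R * h by rewrite mulr_ge0.
    have iT : i%:R * h + h <= T.
      by rewrite -hT -[X in _ + X]mul1r -mulrDl natr1 ler_wpM2r// ler_nat.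
    have := Hg _ _ ia h0 iT; have := Hphi _ _ ia h0 iT.
    rewrite -natr1 mulrDl mul1r (mulrDl _ 1) mul1r.
    move: IH; set a := i%:R * h; set b := i%:R * _.
    rewrite !ler_norml => /andP[? ?] /andP[? ?] /andP[? ?]; apply/andP; split; lra.
  have := step _ (leqnn _); rewrite hT => /le_trans; apply.
  suff -> : m.+1%:R * (2 * A * h ^+ 2) = 2 * A * T ^+ 2 / m.+1%:R by [].
  by rewrite /h; field; rewrite addrC natr1 pnatr_eq0.
apply/ler_addgt0Pr => e e0; rewrite add0r.
have [m hm] : exists m : nat, 2 * A * T ^+ 2 / e < m.+1%:R.
  exists (Num.truncn `|2 * A * T ^+ 2 / e|).
  by apply: (le_lt_trans (ler_norm _)); exact: truncnS_gt.
apply: (le_trans (key m)); rewrite ler_pdivrMr//.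
by rewrite -ler_pdivrMl// (mulrC e^-1) ltW.
Qed.

(** The remainder for the power p + 1 is a + h times the remainder for p, plus h^2 p a^(p-1). *)
Lemma forward_difference_exprn (p : nat) (M : R) : 0 <= M ->
  exists2 C : R, 0 <= C & forall a h : R, 0 <= a -> 0 <= h -> a + h <= M ->
  `|(a + h) ^+ p - a ^+ p - h * (p%:R * a ^+ p.-1)| <= C * h ^+ 2.
Proof.
move=> M0; elim: p => [|p [C C0 IH]].
  exists 0 => // a h a0 h0 _.
  by rewrite !expr0 subrr mul0r mulr0 subrr normr0 mul0r.
exists (M * C + p%:R * M ^+ p.-1).
  by rewrite addr_ge0 ?mulr_ge0 ?exprn_ge0.
move=> a h a0 h0 ahM; have := IH _ _ a0 h0 ahM.
set E := (X in `|X|) => HE.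
have -> : (a + h) ^+ p.+1 - a ^+ p.+1 - h * (p.+1%:R * a ^+ p.+1.-1) =
    (a + h) * E + h ^+ 2 * (p%:R * a ^+ p.-1).
  rewrite /E -natr1; case: p {IH E HE} => [|p] /=.
    by rewrite !expr0 !expr1; ring.
  by rewrite !exprS; ring.
rewrite [X in _ <= X]mulrDl; apply: (le_trans (ler_normD _ _)); apply: lerD.
  rewrite normrM ger0_norm ?addr_ge0// -mulrA.
  by rewrite ler_pM// addr_ge0.
rewrite ger0_norm ?mulr_ge0 ?exprn_ge0// mulrC ler_wpM2r ?exprn_ge0//.
by rewrite ler_wpM2l// lerXn2r ?nnegrE//; lra.
Qed.

Lemma lipschitz_exprn (p : nat) (M : R) : 0 <= M ->
  exists2 L : R, 0 <= L & forall a b : R, 0 <= a <= M -> 0 <= b <= M ->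
  `|a ^+ p - b ^+ p| <= L * `|a - b|.
Proof.
move=> M0; elim: p => [|p [L L0 IH]].
  by exists 0 => // a b _ _; rewrite !expr0 subrr normr0 mul0r.
exists (M ^+ p + M * L) => [|a b aM bM].
  by rewrite addr_ge0 ?mulr_ge0 ?exprn_ge0.
have -> : a ^+ p.+1 - b ^+ p.+1 = (a - b) * a ^+ p + b * (a ^+ p - b ^+ p).
  by rewrite !exprS; ring.
move: (aM) (bM) => /andP[a0 aM'] /andP[b0 bM'].
rewrite [X in _ <= X]mulrDl; apply: (le_trans (ler_normD _ _)); apply: lerD.
  rewrite normrM mulrC ler_wpM2r// ger0_norm ?exprn_ge0//.
  by rewrite lerXn2r ?nnegrE.
rewrite normrM ger0_norm// -mulrA; apply: ler_pM => //; exact: IH.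
Qed.

End forward_difference.

(** * Volumes of surviving jump configurations *)

Section survival_coefficient.
Context (R : realType).

(** With the factor e^(-lambda s) lambda^n removed, the probability in question becomes the volume
    of the set of ordered n-tuples of jump times in [0, s] whose path survives and ends at or above
    x. *)
Definition survival_coef (n : nat) (s x : R) : R :=
  ((s + x) / 2) ^+ n./2 * ((s - x) / 2) ^+ (uphalf n) /
  ((n./2)`!%:R * (uphalf n)`!%:R).

(** The one-step bounds evaluate the previous level at points shifted by O(h); since that value is
    multiplied by h, a Lipschitz bound makes the shift cost only O(h^2). *)
Lemma survival_coef_lipschitz n (t : R) : 0 <= t ->
  exists2 L : R, 0 <= L & forall s x y : R, 0 <= x <= s -> 0 <= y <= s -> s <= t ->
  `|survival_coef n s x - survival_coef n s y| <= L * `|x - y|.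
Proof.
move=> t0.
have [L1 L10 H1] := lipschitz_exprn n./2 t0.
have [L2 L20 H2] := lipschitz_exprn (uphalf n) t0.
exists (L1 * t ^+ uphalf n + t ^+ n./2 * L2).
  by rewrite addr_ge0// mulr_ge0 ?exprn_ge0.
move=> s x y /andP[x0 xs] /andP[y0 ys] st.
rewrite /survival_coef -mulrBl normrM.
set P := (X in X * _ <= _).
suff HP : P <= (L1 * t ^+ uphalf n + t ^+ n./2 * L2) * `|x - y|.
  apply: le_trans HP; rewrite ler_piMr ?normr_ge0//.
  rewrite ger0_norm ?invr_ge0 ?mulr_ge0//.
  by rewrite invf_le1 ?mulr_gt0 ?ltr0n ?fact_gt0// -natrM ler1n muln_gt0 !fact_gt0.
rewrite /P; set ux := (s + x) / 2; set uy := (s + y) / 2.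
set vx := (s - x) / 2; set vy := (s - y) / 2.
have uxt : 0 <= ux <= t by rewrite /ux; apply/andP; split; lra.
have uyt : 0 <= uy <= t by rewrite /uy; apply/andP; split; lra.
have vxt : 0 <= vx <= t by rewrite /vx; apply/andP; split; lra.
have vyt : 0 <= vy <= t by rewrite /vy; apply/andP; split; lra.
have -> : ux ^+ n./2 * vx ^+ uphalf n - uy ^+ n./2 * vy ^+ uphalf n =
  (ux ^+ n./2 - uy ^+ n./2) * vx ^+ uphalf n +
  uy ^+ n./2 * (vx ^+ uphalf n - vy ^+ uphalf n) by ring.
have dxy : `|(x - y) / 2| <= `|x - y|.
  rewrite normrM (ger0_norm (_ : 0 <= 2^-1)) ?invr_ge0//.
  by have := normr_ge0 (x - y); lra.
have exn_bound (p : nat) z : 0 <= z <= t -> `|z ^+ p| <= t ^+ p.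
  by case/andP => z0 zt; rewrite ger0_norm ?exprn_ge0// lerXn2r ?nnegrE.
rewrite [X in _ <= X]mulrDl; apply: (le_trans (ler_normD _ _)); apply: lerD.
  rewrite normrM mulrAC ler_pM ?exn_bound//.
  apply: (le_trans (H1 _ _ uxt uyt)); apply: ler_wpM2l => //.
  by rewrite (_ : ux - uy = (x - y) / 2)// /ux /uy; lra.
rewrite normrM -mulrA ler_pM ?exn_bound//.
apply: (le_trans (H2 _ _ vxt vyt)); apply: ler_wpM2l => //.
rewrite (_ : vx - vy = - ((x - y) / 2)) ?normrN// /vx /vy; lra.
Qed.

Lemma survival_coef_diag n (s : R) : survival_coef n.+1 s s = 0.
Proof. by rewrite /survival_coef subrr mul0r expr0n mulr0 mul0r. Qed.

End survival_coefficient.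

(** * Uniqueness for the one-step inequalities, by induction on the number of jumps *)

Section survival_recursion.
Context (R : realType) (t : R) (G : nat -> R -> R -> R) (B C : nat -> R).
Hypothesis t_ge0 : 0 <= t.
Hypothesis C_ge0 : forall n, 0 <= C n.
Hypothesis G_ge0 : forall n s x, 0 <= G n s x.
Hypothesis G_le : forall n s x, 0 <= s <= t -> G n s x <= B n.
Hypothesis G_neg : forall n s x, 0 <= s -> x <= 0 -> G n s x = G n s 0.
Hypothesis G_beyond : forall n s x, 0 <= s -> s < x -> G n s x = 0.
Hypothesis G_start : forall n x, G n.+1 0 x = 0.
Hypothesis G_no_jump : forall s x, 0 <= s <= t -> 0 <= x <= s -> G 0 s x = 1.
(** [G] stands for the survival probability times exp(lambda s) / lambda^n; with this normalization
    the step without jump has weight 1 and the step with one jump has weight h. *)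
Hypothesis G_even_step : forall n s h x, odd n ->
  0 <= s -> 0 <= h -> s + h <= t ->
  G n.+1 s x + h * G n s (Num.max (x + 2 * h) h) <= G n.+1 (s + h) (x + h) <=
  G n.+1 s x + h * G n s x + C n.+1 * h ^+ 2.
Hypothesis G_odd_step : forall n s h x, ~~ odd n ->
  0 <= s -> 0 <= h -> s + h <= t -> 0 <= x ->
  G n.+1 s (x + h) + h * G n s (x + h) <= G n.+1 (s + h) x <=
  G n.+1 s (x + h) + h * G n s (x - h) + C n.+1 * h ^+ 2.

Let clamp (s x : R) := Num.min (Num.max x 0) s.

Let clamp_itv s x : 0 <= s -> 0 <= clamp s x <= s.
Proof.
move=> s0; rewrite /clamp le_min s0 andbT.
by rewrite ge_min lexx orbT le_max lexx orbT.
Qed.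

Let clamp_id s x : 0 <= x <= s -> clamp s x = x.
Proof. by case/andP => x0 xs; rewrite /clamp max_l// min_l. Qed.

Let clamp_lip s x y : 0 <= s -> `|clamp s x - clamp s y| <= `|x - y|.
Proof.
move=> s0; have := ler_norm (x - y); have := ler_norm (- (x - y)).
rewrite normrN; set r := `|x - y| => ? ?.
rewrite ler_norml /clamp; have [?|?] := leP x 0; have [?|?] := leP y 0;
by rewrite /Num.min; do ?[case: ifPn; rewrite -?leNgt => ?];
  apply/andP; split; lra.
Qed.

Let solved n := forall s x, 0 <= x <= s -> s <= t -> G n s x = survival_coef n s x.

(** [G] is constant to the left of 0 and vanishes beyond s, which matches the value of the
    coefficient on the diagonal except when n = 0: there the coefficient is 1, hence the side
    condition. *)
Let solved_clamp n s x : solved n -> 0 <= s <= t -> x <= s \/ (0 < n)%N ->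
  G n s x = survival_coef n s (clamp s x).
Proof.
move=> H /andP[s0 st] xn.
have [x0|x0] := lerP x 0.
  by rewrite G_neg// H ?lexx// /clamp max_r// min_l.
have [xs|xs] := lerP x s; first by rewrite H ?(ltW x0)// clamp_id// (ltW x0).
have {xn} n0 : (0 < n)%N by case: xn => //; rewrite leNgt xs.
rewrite G_beyond// /clamp max_l ?(ltW x0)// min_r ?(ltW xs)//.
by case: n n0 {H} => // n _; rewrite survival_coef_diag.
Qed.

Let solved_lip n : solved n -> exists2 L : R, 0 <= L & forall s x y : R, 0 <= s <= t ->
  0 <= y <= s -> x <= s \/ (0 < n)%N ->
  `|G n s x - survival_coef n s y| <= L * `|x - y|.
Proof.
move=> H; have [L L0 HL] := survival_coef_lipschitz n t_ge0.
exists L => // s x y st ys xn; have /andP[s0 st'] := st.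
rewrite (solved_clamp H st xn); apply: (le_trans (HL _ _ _ _ _ _)) => //.
  exact: clamp_itv.
by rewrite ler_wpM2l// -{1}(clamp_id ys) clamp_lip.
Qed.

Let solved0 : solved 0.
Proof.
move=> s x /andP[x0 xs] st; rewrite G_no_jump ?x0 ?xs ?(le_trans x0 xs)//.
by rewrite /survival_coef/= !expr0 mulr1 divr1.
Qed.

(* On the axis x = 0 the even coefficient solves its own equation in s; then
   the flow carries it along the lines s - x = const. *)
Let solved_even n : odd n -> solved n -> solved n.+1.
Proof.
move=> on Hn.
have [L L0 HL] := solved_lip Hn.
have n0 : (0 < n)%N by case: n on {Hn HL}.
pose k := n./2.
have nE : n = k.*2.+1 by rewrite -[LHS]odd_double_half on.
have n1E : n.+1 = k.+1.*2 by rewrite nE doubleS.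
have hn : n.+1./2 = k.+1 by rewrite n1E doubleK.
have un : uphalf n.+1 = k.+1 by rewrite n1E uphalf_double.
have hn' : n./2 = k by [].
have un' : uphalf n = k.+1 by rewrite -hn.
have f1 : (k.+1)%:R != 0 :> R by rewrite pnatr_eq0.
have f2 : (k`!)%:R != 0 :> R by rewrite pnatr_eq0 -lt0n fact_gt0.
have axis s : 0 <= s <= t -> G n.+1 s 0 = survival_coef n.+1 s 0.
  case/andP => s0 st.
  have [D D0 HD] := forward_difference_exprn (k.+1).*2 t_ge0.
  apply: (@forward_difference_unique _ (fun a => G n.+1 a 0)
    (fun a => survival_coef n.+1 a 0) (fun a => survival_coef n a 0) s
    (C n.+1 + L + D)) => //.
  - by rewrite G_start survival_coef_diag.
  - move=> a h a0 h0 ahs.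
    have aht : a + h <= t by exact: le_trans st.
    (* With x = -h the arrival level x + h is 0, the departure level may be replaced by 0 through
       [G_neg], and the maximum becomes h. *)
    have := @G_even_step n a h (- h) on a0 h0 aht.
    rewrite addNr (G_neg _ a0 (_ : - h <= 0)) ?oppr_le0//.
    have -> : Num.max (- h + 2 * h) h = h by rewrite max_r//; lra.
    have a_t : 0 <= a <= t by apply/andP; split; lra.
    have := @HL a h 0 a_t _ (or_intror n0); rewrite lexx a0 => /(_ isT).
    rewrite subr0 (ger0_norm h0) (@G_neg n a (- h)) ?oppr_le0//.
    rewrite (Hn a 0) ?lexx//; last lra.
    set K := survival_coef n a 0; move=> HL1 /andP[lo hi].
    have hL : h * K - h * G n a h <= L * h ^+ 2.
      rewrite -mulrBr expr2 mulrCA ler_wpM2l//.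
      by move: HL1; rewrite distrC => /(le_trans (ler_norm _)).
    have h2 : 0 <= h ^+ 2 by exact: exprn_ge0.
    have cnh : 0 <= C n.+1 * h ^+ 2 by rewrite mulr_ge0.
    have lh : 0 <= L * h ^+ 2 by rewrite mulr_ge0.
    have dh : 0 <= D * h ^+ 2 by rewrite mulr_ge0.
    rewrite ler_norml !mulrDl; apply/andP; split; lra.
  - move=> a h a0 h0 ahs.
    (* On the axis both u and v equal a/2, so the coefficient is a single power of a/2, with
       increment h/2. *)
    have Ha : 0 <= a / 2 by lra.
    have Hh : 0 <= h / 2 by lra.
    have Hah : a / 2 + h / 2 <= t by lra.
    have := HD _ _ Ha Hh Hah.
    have h2 : 0 <= h ^+ 2 by exact: exprn_ge0.
    set E := (X in `|X|) => HE.
    have -> : survival_coef n.+1 (a + h) 0 - survival_coef n.+1 a 0 -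
        h * survival_coef n a 0 = E / (k.+1`!%:R * k.+1`!%:R).
      rewrite /survival_coef hn un hn' un' !addr0 !subr0 -!exprD addnn.
      rewrite /E [(a + h) / 2]mulrDl doubleS/= factS natrM.
      have -> : (k + k.+1)%N = k.*2.+1 by rewrite addnS addnn.
      rewrite (_ : (k.*2.+2)%:R = 2 * k.+1%:R :> R); last first.
        by rewrite -doubleS -muln2 natrM mulrC.
      move: f1 f2; set x := k.+1%:R; set y := k`!%:R => ? ?.
      by field; apply/andP.
    rewrite normrM; apply: (@le_trans _ _ `|E|).
      rewrite ler_piMr ?normr_ge0// ger0_norm ?invr_ge0 ?mulr_ge0//.
      by rewrite invf_le1 ?mulr_gt0 ?ltr0n ?fact_gt0// -natrM ler1n muln_gt0 !fact_gt0.
    apply: (le_trans HE); rewrite expr_div_n.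
    have := C_ge0 n.+1; have : 0 <= (h ^+ 2) by []; set h' := h ^+ 2.
    move=> ? ?; have : 0 <= D * h' by rewrite mulr_ge0.
    have : 0 <= L * h' by rewrite mulr_ge0.
    have : 0 <= C n.+1 * h' by rewrite mulr_ge0.
    rewrite !mulrDl; lra.
move=> s x /andP[x0 xs] st.
pose s0 := s - x.
have s00 : 0 <= s0 by rewrite /s0; lra.
have [D D0 HD] := forward_difference_exprn k.+1 t_ge0.
(* Along s - x = s0 the factor v = s0/2 is constant and only u = s0/2 + a moves; [W] bounds the
   power of v. *)
pose W : R := (t / 2) ^+ k.+1.
have W0 : 0 <= W by rewrite exprn_ge0//; lra.
have := @forward_difference_unique _ (fun a => G n.+1 (s0 + a) a)
    (fun a => survival_coef n.+1 (s0 + a) a) (fun a => survival_coef n (s0 + a) a) x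
    (C n.+1 + 2 * L + D * W).
have -> : s0 + x = s by rewrite /s0; lra.
apply => //.
- by rewrite addr0 axis//; apply/andP; split => //; rewrite /s0; lra.
- move=> a h a0 h0 ahx.
  have sa0 : 0 <= s0 + a by lra.
  have saht : s0 + a + h <= t by rewrite /s0; lra.
  have := @G_even_step n (s0 + a) h a on sa0 h0 saht.
  rewrite max_l; last lra.
  have sat : 0 <= s0 + a <= t by apply/andP; split; lra.
  have aas : 0 <= a <= s0 + a by apply/andP; split; lra.
  have := @HL (s0 + a) (a + 2 * h) a sat aas (or_intror n0).
  rewrite (_ : a + 2 * h - a = 2 * h); last by ring.
  rewrite (ger0_norm (_ : 0 <= 2 * h)); last lra.
  rewrite (Hn (s0 + a) a)//; last by case/andP: sat.
  set K := survival_coef n (s0 + a) a => HL1 /andP[lo hi].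
  have hL : h * K - h * G n (s0 + a) (a + 2 * h) <= 2 * L * h ^+ 2.
    rewrite -mulrBr (_ : 2 * L * h ^+ 2 = h * (L * (2 * h))); last by ring.
    by rewrite ler_wpM2l//; move: HL1; rewrite distrC => /(le_trans (ler_norm _)).
  have h2 : 0 <= h ^+ 2 by exact: exprn_ge0.
  have cnh : 0 <= C n.+1 * h ^+ 2 by rewrite mulr_ge0.
  have lh : 0 <= 2 * L * h ^+ 2 by rewrite !mulr_ge0.
  have dh : 0 <= D * W * h ^+ 2 by rewrite !mulr_ge0.
  rewrite ler_norml !mulrDl (addrA s0 a h); apply/andP; split; lra.
- move=> a h a0 h0 ahx.
  have Ha : 0 <= s0 / 2 + a by lra.
  have Hah : s0 / 2 + a + h <= t by rewrite /s0; lra.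
  have := HD _ _ Ha h0 Hah.
  have h2 : 0 <= h ^+ 2 by exact: exprn_ge0.
  set E := (X in `|X|) => HE.
  have -> : survival_coef n.+1 (s0 + (a + h)) (a + h) -
      survival_coef n.+1 (s0 + a) a - h * survival_coef n (s0 + a) a =
      E * (s0 / 2) ^+ k.+1 / (k.+1`!%:R * k.+1`!%:R).
    rewrite /survival_coef hn un hn' un' /E.
    rewrite (_ : s0 + (a + h) - (a + h) = s0); last by ring.
    rewrite (_ : s0 + a - a = s0); last by ring.
    rewrite (_ : (s0 + (a + h) + (a + h)) / 2 = s0 / 2 + a + h); last by field.
    rewrite (_ : (s0 + a + a) / 2 = s0 / 2 + a); last by field.
    rewrite factS natrM/=.
    move: f1 f2; set x' := k.+1%:R; set y := k`!%:R => ? ?.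
    by field; apply/andP.
  rewrite normrM; apply: (@le_trans _ _ `|E * (s0 / 2) ^+ k.+1|).
    rewrite ler_piMr ?normr_ge0// ger0_norm ?invr_ge0 ?mulr_ge0//.
    by rewrite invf_le1 ?mulr_gt0 ?ltr0n ?fact_gt0// -natrM ler1n muln_gt0 !fact_gt0.
  rewrite normrM (ger0_norm (exprn_ge0 _ _)); last by lra.
  apply: (@le_trans _ _ (D * h ^+ 2 * W)).
    apply: ler_pM => //; first by rewrite exprn_ge0//; lra.
    by rewrite /W lerXn2r ?nnegrE//; rewrite /s0; lra.
  have : 0 <= 2 * L * h ^+ 2 by rewrite !mulr_ge0.
  have : 0 <= C n.+1 * h ^+ 2 by rewrite mulr_ge0.
  rewrite !mulrDl (_ : D * h ^+ 2 * W = D * W * h ^+ 2); last by ring.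
  lra.
Qed.

(** A particle moving down follows s + x = const. There u is constant and v grows from 0, so the
    characteristic starts on the diagonal, where both sides vanish. *)
Let solved_odd n : ~~ odd n -> solved n -> solved n.+1.
Proof.
move=> en Hn.
have [L L0 HL] := solved_lip Hn.
pose k := n./2.
have nE : n = k.*2 by rewrite -[LHS]odd_double_half (negbTE en).
have hn' : n./2 = k by [].
have hn : n.+1./2 = k by rewrite nE -uphalfE uphalf_double.
have un' : uphalf n = k by rewrite -[LHS]/(n.+1./2).
have un : uphalf n.+1 = k.+1 by rewrite uphalfE/= hn'.
have f1 : (k.+1)%:R != 0 :> R by rewrite pnatr_eq0.
have f2 : (k`!)%:R != 0 :> R by rewrite pnatr_eq0 -lt0n fact_gt0.
(* A step of length h ending at (s, s) takes its main term at time s - h and height s + h, out of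
   reach. What remains is at most h B(n) + C(n+1) h^2, arbitrarily small. *)
have diag s : 0 <= s <= t -> G n.+1 s s = 0.
  case/andP => s0 st; move: s0; rewrite le_eqVlt => /predU1P[<-|s0]; first exact: G_start.
  apply/eqP; rewrite eq_le G_ge0 andbT; apply/ler_addgt0Pr => e e0; rewrite add0r.
  have B0 : 0 <= B n by apply: le_trans (G_le n 0 (_ : 0 <= 0 <= t)) => //; rewrite lexx.
  pose q := B n + C n.+1 * t + 1.
  have q0 : 0 < q by rewrite /q; have := mulr_ge0 (C_ge0 n.+1) t_ge0; lra.
  pose h := Num.min s (e / q).
  have h0 : 0 < h by rewrite lt_min s0 divr_gt0.
  have hs : h <= s by rewrite ge_min lexx.
  have he : h * q <= e by rewrite -ler_pdivlMr// ge_min lexx orbT.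
  have sh0 : 0 <= s - h by lra.
  have := @G_odd_step n (s - h) h s en sh0 (ltW h0).
  rewrite subrK => /(_ st (ltW s0)) /andP[_].
  rewrite (G_beyond _ sh0); last lra.
  have := @G_le n (s - h) (s - h); rewrite sh0/= => /(_ _)/wrap[|Gle]; first lra.
  move=> /le_trans; apply; apply: le_trans he.
  have : h * G n (s - h) (s - h) <= h * B n by rewrite ler_wpM2l// ltW.
  have : C n.+1 * h ^+ 2 <= C n.+1 * (h * t).
    by rewrite ler_wpM2l// expr2 ler_wpM2l ?(ltW h0)//; lra.
  rewrite /q; lra.
move=> s x /andP[x0 xs] st.
pose s0 := (s + x) / 2.
have s00 : 0 <= s0 by rewrite /s0; lra.
pose y := (s - x) / 2.
have y0 : 0 <= y by rewrite /y; lra.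
have ys0 : y <= s0 by rewrite /y /s0; lra.
have [D D0 HD] := forward_difference_exprn k.+1 t_ge0.
pose W : R := t ^+ k.
have W0 : 0 <= W by rewrite exprn_ge0//; lra.
have := @forward_difference_unique _ (fun a => G n.+1 (s0 + a) (s0 - a))
    (fun a => survival_coef n.+1 (s0 + a) (s0 - a))
    (fun a => survival_coef n (s0 + a) (s0 - a)) y
    (C n.+1 + 2 * L + D * W).
have -> : s0 + y = s by rewrite /s0 /y; lra.
have -> : s0 - y = x by rewrite /s0 /y; lra.
apply => //.
- rewrite addr0 subr0 diag ?survival_coef_diag//.
  by apply/andP; split => //; rewrite /s0; lra.
- move=> a h a0 h0 ahx.
  have sa0 : 0 <= s0 + a by lra.
  have saht : s0 + a + h <= t.
    by apply: le_trans st; rewrite -addrA; move: ahx; rewrite /s0 /y; lra.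
  have x0' : 0 <= s0 - (a + h) by lra.
  have := @G_odd_step n (s0 + a) h (s0 - (a + h)) en sa0 h0 saht x0'.
  rewrite (_ : s0 - (a + h) + h = s0 - a); last by ring.
  have sat : 0 <= s0 + a <= t by apply/andP; split; lra.
  have aas : 0 <= s0 - a <= s0 + a by apply/andP; split; lra.
  have xs' : s0 - (a + h) - h <= s0 + a by lra.
  have := @HL (s0 + a) (s0 - (a + h) - h) (s0 - a) sat aas (or_introl xs').
  rewrite (_ : s0 - (a + h) - h - (s0 - a) = - (2 * h)); last by ring.
  rewrite normrN (ger0_norm (_ : 0 <= 2 * h)); last lra.
  rewrite (Hn (s0 + a) (s0 - a))//; last by case/andP: sat.
  set K := survival_coef n (s0 + a) (s0 - a) => HL1 /andP[lo hi].
  have hL : h * G n (s0 + a) (s0 - (a + h) - h) - h * K <= 2 * L * h ^+ 2.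
    rewrite -mulrBr (_ : 2 * L * h ^+ 2 = h * (L * (2 * h))); last by ring.
    by rewrite ler_wpM2l//; exact: (le_trans (ler_norm _)).
  have h2 : 0 <= h ^+ 2 by exact: exprn_ge0.
  have cnh : 0 <= C n.+1 * h ^+ 2 by rewrite mulr_ge0.
  have lh : 0 <= 2 * L * h ^+ 2 by rewrite !mulr_ge0.
  have dh : 0 <= D * W * h ^+ 2 by rewrite !mulr_ge0.
  rewrite ler_norml !mulrDl (addrA s0 a h); apply/andP; split; lra.
- move=> a h a0 h0 ahx.
  have Hah : a + h <= t by move: ahx; rewrite /y; lra.
  have := HD _ _ a0 h0 Hah.
  have h2 : 0 <= h ^+ 2 by exact: exprn_ge0.
  set E := (X in `|X|) => HE.
  have -> : survival_coef n.+1 (s0 + (a + h)) (s0 - (a + h)) -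
      survival_coef n.+1 (s0 + a) (s0 - a) - h * survival_coef n (s0 + a) (s0 - a) =
      E * s0 ^+ k / (k`!%:R * k.+1`!%:R).
    rewrite /survival_coef hn un hn' un' /E.
    rewrite (_ : (s0 + (a + h) + (s0 - (a + h))) / 2 = s0); last by field.
    rewrite (_ : (s0 + a + (s0 - a)) / 2 = s0); last by field.
    rewrite (_ : (s0 + (a + h) - (s0 - (a + h))) / 2 = a + h); last by field.
    rewrite (_ : (s0 + a - (s0 - a)) / 2 = a); last by field.
    rewrite factS natrM/=.
    move: f1 f2; set x' := k.+1%:R; set z := k`!%:R => ? ?.
    by field; apply/andP.
  rewrite normrM; apply: (@le_trans _ _ `|E * s0 ^+ k|).
    rewrite ler_piMr ?normr_ge0// ger0_norm ?invr_ge0 ?mulr_ge0//.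
    by rewrite invf_le1 ?mulr_gt0 ?ltr0n ?fact_gt0// -natrM ler1n muln_gt0 !fact_gt0.
  rewrite normrM (ger0_norm (exprn_ge0 _ _)); last by lra.
  apply: (@le_trans _ _ (D * h ^+ 2 * W)).
    apply: ler_pM => //; first by rewrite exprn_ge0//; lra.
    by rewrite /W lerXn2r ?nnegrE//; rewrite /s0; lra.
  have : 0 <= 2 * L * h ^+ 2 by rewrite !mulr_ge0.
  have : 0 <= C n.+1 * h ^+ 2 by rewrite mulr_ge0.
  rewrite !mulrDl (_ : D * h ^+ 2 * W = D * W * h ^+ 2); last by ring.
  lra.
Qed.

Lemma survival_recursion_unique n s x : 0 <= x <= s -> s <= t ->
  G n s x = survival_coef n s x.
Proof.
elim: n s x => [|n IH]; first exact: solved0.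
by have [on|en] := boolP (odd n); [exact: solved_even|exact: solved_odd].
Qed.

End survival_recursion.

(** * Independence of the survival events from later increments *)

Section poisson_telegraph.
Context (R : realType) d (Omega : measurableType d) (P : probability Omega R).
Context (lambda : R) (N : R -> {RV P >-> nat}).
Hypothesis N_poisson : is_poisson_process lambda N.

Local Notation count := (fun s => N s : Omega -> nat).
Local Notation S w := (unit_telegraph (fun s => count s w)).
Local Notation inc s u := (increment count s u).

(** [pT] is [Omega] with only the events of the counting process. Independence of [V0] is assumed
    for this sigma-algebra, so the measurability of survival events has to be established in it. *)
Let generator : set (set Omega) :=
  [set E | exists (s : R) (B : set nat), 0 <= s /\ E = count s @^-1` B].
Let pT := g_sigma_algebraType generator.

Let count_nd w (s u : R) : 0 <= s -> s <= u -> (N s w <= N u w)%N.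
Proof. exact: (poisson_process_nondecreasing N_poisson). Qed.

Let count0 w : N 0 w = 0%N.
Proof. exact: (poisson_process_start N_poisson). Qed.

Lemma process_sigma_algebra_measurable (E : set Omega) :
  process_sigma_algebra count E -> measurable E.
Proof.
apply: smallest_sub => [|F [s [B [_ ->]]]].
  exact: sigma_algebra_measurable.
by rewrite -[X in measurable X]setTI; exact: measurable_funPT.
Qed.

Lemma measurable_count s : 0 <= s -> measurable_fun [set: pT] (count s : pT -> nat).
Proof.
move=> s0 _ B _; rewrite setTI; apply: sub_sigma_algebra.
by exists s, B.
Qed.

Lemma measurable_riemann_telegraph h M : 0 <= h ->
  measurable_fun [set: pT]
    (fun w : pT => riemann_telegraph (fun s => count s w) h M : R).
Proof.
move=> h0; apply: measurable_sum => i; apply: measurable_funM => //.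
apply: (@measurableT_comp _ _ _ _ _ _ (fun k : nat => (-1) ^+ k : R)) => //.
by apply: measurable_count; rewrite mulr_ge0.
Qed.

Lemma measurable_unit_telegraph s : 0 <= s ->
  measurable_fun [set: pT] (fun w : pT => S w s : R).
Proof.
move=> s0.
apply: (@measurable_fun_cvg _ _ _ _ (fun (m : nat) (w : pT) =>
  riemann_telegraph (fun s => count s w) (s / m.+1%:R) m.+1)).
  by move=> m; apply: measurable_riemann_telegraph; rewrite divr_ge0.
move=> w _; apply/cvgrPdist_le => e e0.
have m_ge : \forall m \near \oo, 2 * s * (N s w)%:R / e <= m%:R :> R.
  exact: nbhs_infty_ger.
near=> m.
have := @riemann_telegraph_error _ _ (count_nd w) (s / m.+1%:R) m.+1 (divr_ge0 s0 (ler0n _ _)).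
rewrite (mulrC m.+1%:R) divfK// => /le_trans; apply.
rewrite mulrA mulrAC ler_pdivrMr//.
have : 2 * s * (N s w)%:R / e <= m.+1%:R.
  have : 2 * s * (N s w)%:R / e <= m%:R by near: m.
  by move=> /le_trans; apply; rewrite ler_nat.
by rewrite ler_pdivrMr// (mulrC e).
Unshelve. all: by end_near. Qed.

(** These are the events that the hypothesis on finitely many increments can reach. *)
Definition grid_determined (h : R) (M : nat) (E : set Omega) :=
  forall w w', (forall i, (i <= M)%N -> N (i%:R * h) w = N (i%:R * h) w') ->
    E w -> E w'.

Lemma increment_grid h M w w' : 0 <= h ->
  (forall i, (i < M)%N ->
     inc (i%:R * h) (i.+1%:R * h) w = inc (i%:R * h) (i.+1%:R * h) w') ->
  forall i, (i <= M)%N -> N (i%:R * h) w = N (i%:R * h) w'.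
Proof.
move=> h0 ww'; elim=> [|i IH] iM; first by rewrite mul0r !count0.
have := ww' i iM; rewrite /increment => e.
have nd v : (N (i%:R * h) v <= N (i.+1%:R * h) v)%N.
  by apply: count_nd; rewrite ?mulr_ge0// ler_wpM2r// ler_nat.
by rewrite -(subnK (nd w)) -(subnK (nd w')) e IH// ltnW.
Qed.

Lemma measurable_increment s u (B : set nat) : measurable (inc s u @^-1` B).
Proof.
rewrite (_ : _ @^-1` _ = \bigcup_k \bigcup_(l in [set l | B (l - k)%N])
  (count s @^-1` [set k] `&` count u @^-1` [set l])); last first.
  apply/seteqP; split=> [w Bw|w [k _ [l Bl [/= sk ul]]]].
    by exists (N s w) => //; exists (N u w).
  by rewrite /= /increment sk ul.
apply: bigcup_measurable => k _; apply: bigcup_measurable => l _.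
by apply: measurableI; rewrite -[X in measurable X]setTI; exact: measurable_funPT.
Qed.

Let measurable_inc s u B : measurable (inc s u @^-1` B) :=
  measurable_increment s u B.

Lemma grid_cell_independent h M u w0 (B : set nat) : 0 <= h -> M%:R * h <= u ->
  let F := [set w | forall i, (i <= M)%N -> N (i%:R * h) w = N (i%:R * h) w0] in
  measurable F /\ P (F `&` inc (M%:R * h) u @^-1` B) =
  (P F * P (inc (M%:R * h) u @^-1` B))%E.
Proof.
move=> h0 Mu F.
(* The grid is extended by the single time u, so that the increment number M is the one over
   [Mh, u]. *)
pose s i := if (i <= M)%N then i%:R * h else u.
have s0 : 0 <= s 0%N by rewrite /s leq0n mul0r.
have snd : {homo s : i j / (i <= j)%N >-> i <= j}.
  move=> i j ij; rewrite /s; case: (leqP j M) => jM.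
    by rewrite (leq_trans ij jM) ler_wpM2r// ler_nat.
  case: leqP => // iM; apply: le_trans Mu.
  by rewrite ler_wpM2r// ler_nat.
pose cell B' (i : 'I_M.+1) : set nat :=
  if (i < M)%N then [set inc (i%:R * h) (i.+1%:R * h) w0] else B'.
have sE i : (i < M)%N -> (s i = i%:R * h) * (s i.+1 = i.+1%:R * h).
  by move=> iM; rewrite /s iM ltnW.
have sM : (s M = M%:R * h) * (s M.+1 = u) by rewrite /s leqnn ltnn.
have FE B' : F `&` inc (M%:R * h) u @^-1` B' =
    \bigcap_(i in [set: 'I_M.+1]) (inc (s i) (s i.+1) @^-1` cell B' i).
  apply/seteqP; split=> [w [Fw Bw] i _|w Fw].
    rewrite /= /cell; case: ltnP => iM; last first.
      have -> : i = M :> nat by apply/eqP; rewrite eqn_leq iM -ltnS ltn_ord.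
      by rewrite !sM.
    have Fw' j : (j <= M)%N -> N (j%:R * h) w = N (j%:R * h) w0 := Fw j.
    by rewrite !(sE _ iM)/= /increment !Fw'// ltnW.
  split.
    apply: increment_grid => // i iM.
    have := Fw (widen_ord (leqnSn M) (Ordinal iM)) I.
    by rewrite /= /cell/= iM !(sE _ iM).
  by have := Fw ord_max I; rewrite /= /cell/= ltnn !sM.
(* Kept general in [B']: the choice [setT] gives the probability of [F] itself as the product over
   the grid. *)
have PE B' : P (F `&` inc (M%:R * h) u @^-1` B') =
    (\prod_(i < M) P (inc (s i) (s i.+1) @^-1` [set inc (i%:R * h) (i.+1%:R * h) w0])
     * P (inc (M%:R * h) u @^-1` B'))%E.
  rewrite FE (poisson_process_independent_increments N_poisson s0 snd)//.
  rewrite big_ord_recr/= /cell/= ltnn !sM; congr (_ * _)%E.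
  by apply: eq_bigr => i _; rewrite /= ltn_ord.
have FT : F = F `&` inc (M%:R * h) u @^-1` setT by rewrite preimage_setT setIT.
split.
  rewrite FT FE; apply: fin_bigcap_measurable.
    exact: finite_finset.
  by [].
by rewrite PE [in RHS]FT PE preimage_setT probability_setT mule1.
Qed.

(** The event is a countable disjoint union of cells on which all grid counts are fixed;
    independence is summed over the cells. *)
Lemma grid_determined_independent h M u (E : set Omega) (B : set nat) :
  0 <= h -> M%:R * h <= u -> grid_determined h M E -> measurable E ->
  P (E `&` inc (M%:R * h) u @^-1` B) = (P E * P (inc (M%:R * h) u @^-1` B))%E.
Proof.
move=> h0 Mu gE mE.
(* Encoding the tuple of counts by an integer turns the union over cells into a sequence. *)
pose cell w := pickle [tuple N (i%:R * h) w | i < M.+1].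
have cellP w w' : cell w = cell w' <->
    forall i, (i <= M)%N -> N (i%:R * h) w = N (i%:R * h) w'.
  split=> [/(pcan_inj pickleK) ww' i iM|ww'].
    have iM' : (i < M.+1)%N by [].
    by have := congr1 (fun v => tnth v (Ordinal iM')) ww'; rewrite !tnth_mktuple.
  by congr pickle; apply: eq_from_tnth => i; rewrite !tnth_mktuple ww'// -ltnS.
pose F k := E `&` [set w | cell w = k].
have EF : E = \bigcup_k F k.
  by apply/seteqP; split=> [w Ew|w [k _ []//]]; exists (cell w).
have FP k : measurable (F k) /\ P (F k `&` inc (M%:R * h) u @^-1` B) =
    (P (F k) * P (inc (M%:R * h) u @^-1` B))%E.
  have [F0|/set0P[w0 [Ew0 w0k]]] := eqVneq (F k) set0.
    by rewrite F0 set0I measure0 mul0e.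
  suff -> : F k = [set w | forall i, (i <= M)%N -> N (i%:R * h) w = N (i%:R * h) w0].
    exact: grid_cell_independent.
  apply/seteqP; split=> [w [Ew wk]|w ww0]; first by apply/cellP; rewrite wk.
  split; last by rewrite -w0k; apply/cellP.
  by apply: gE Ew0 => i iM; rewrite ww0.
have tF : trivIset setT F by move=> k l _ _ [w [[_ <-] [_ <-]]].
rewrite {1}EF setI_bigcupl measure_bigcup//; last 2 first.
- by move=> k _; apply: measurableI; [exact: (FP k).1|exact: measurable_inc].
- by move=> k l _ _ [w [[Fk _] [Fl _]]]; apply: tF => //; exists w.
rewrite muleC -(fineK (fin_num_measure P _ (measurable_inc _ _ B))).
rewrite [X in P X]EF measure_bigcup//; last by move=> k _; exact: (FP k).1.
rewrite -nneseriesZl//; apply: eq_eseriesr => k _.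
apply: etrans (FP k).2 _; rewrite muleC fineK//; exact: fin_num_measure.
Qed.

Definition surviving (n : nat) (s x : R) : set Omega :=
  [set w | [/\ N s w = n, forall r, 0 <= r <= s -> 0 <= S w r & x <= S w s]].

(* A grid of mesh h sees the path up to an error 2 h N(s); relaxing both
   constraints by that much gives grid events decreasing to [surviving]. *)
Let grid_surviving n s x (m : nat) : set Omega :=
  [set w | N s w = n /\ forall j, (j <= m)%N ->
    let h := s / (2 ^ j)%:R in
    (forall i, (i <= 2 ^ j)%N ->
       - (2 * h * n%:R) <= riemann_telegraph (fun s => count s w) h i) /\
    x - 2 * h * n%:R <= riemann_telegraph (fun s => count s w) h (2 ^ j)].

Let mesh_mul (s : R) j : (2 ^ j)%:R * (s / (2 ^ j)%:R) = s.
Proof. by rewrite mulrC divfK// pnatr_eq0 -lt0n expn_gt0. Qed.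

Let mesh_ge0 (s : R) j : 0 <= s -> 0 <= s / (2 ^ j)%:R.
Proof. by move=> s0; rewrite divr_ge0. Qed.

Let mesh_small (s e K : R) : 0 <= s -> 0 < e -> exists j, K * (s / (2 ^ j)%:R) <= e.
Proof.
move=> s0 e0; exists (Num.truncn `|K * s / e|).
set j := Num.truncn _.
rewrite mulrA ler_pdivrMr; last by rewrite ltr0n expn_gt0.
rewrite -ler_pdivrMl// (mulrC e^-1); apply: (le_trans (ler_norm _)).
apply: (le_trans (ltW (truncnS_gt _))); rewrite ler_nat.
exact: ltn_expl.
Qed.

Let surviving_grid n s x : 0 <= s ->
  surviving n s x = \bigcap_m grid_surviving n s x m.
Proof.
move=> s0; apply/seteqP; split=> [w [Nw S0 Sx] m _|w gw].
  split => // j _ h.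
  have h0 : 0 <= h by exact: mesh_ge0.
  have err i : (i <= 2 ^ j)%N ->
      S w (i%:R * h) - riemann_telegraph (fun s => count s w) h i <= 2 * h * n%:R.
    move=> ij; apply: (le_trans (ler_norm _)).
    apply: (le_trans (riemann_telegraph_error (count_nd w) i h0)).
    rewrite ler_wpM2l ?mulr_ge0// ler_nat -Nw; apply: count_nd.
      by rewrite mulr_ge0.
    by rewrite -[X in _ <= X](mesh_mul s j) ler_wpM2r// ler_nat.
  split=> [i ij|].
    have := err _ ij; have : 0 <= S w (i%:R * h).
      apply: S0; rewrite mulr_ge0//= -[X in _ <= X](mesh_mul s j).
      by rewrite ler_wpM2r// ler_nat.
    lra.
  by have := err _ (leqnn _); rewrite mesh_mul; lra.
have Nw : N s w = n by case: (gw 0%N I).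
have err j i : (i <= 2 ^ j)%N ->
    riemann_telegraph (fun s => count s w) (s / (2 ^ j)%:R) i -
    S w (i%:R * (s / (2 ^ j)%:R)) <= 2 * (s / (2 ^ j)%:R) * n%:R.
  move=> ij; apply: (le_trans (ler_norm _)); rewrite distrC.
  apply: (le_trans (riemann_telegraph_error (count_nd w) i (mesh_ge0 j s0))).
  rewrite ler_wpM2l ?mulr_ge0 ?mesh_ge0// ler_nat -Nw; apply: count_nd.
    by rewrite mulr_ge0 ?mesh_ge0.
  by rewrite -[X in _ <= X](mesh_mul s j) ler_wpM2r ?mesh_ge0// ler_nat.
split => // [r /andP[r0 rs]|].
  apply/ler_addgt0Pr => e e0.
  (* The relaxed constraint and the Riemann error cost 2hn each, and moving from the grid point on
     the left of r to r costs h. At time s, a grid point, this last h disappears. *)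
  have [j hj] := mesh_small (4 * n%:R + 1) s0 e0.
  have [_ /(_ j (leqnn j)) /= [gj _]] := gw j I.
  have : exists2 i, (i <= 2 ^ j)%N & i%:R * (s / (2 ^ j)%:R) <= r <= i.+1%:R * (s / (2 ^ j)%:R).
    move: s0; rewrite le_eqVlt => /predU1P[s00|s0].
      by exists 0%N => //; rewrite -s00 !mul0r !mulr0 r0 s00 rs.
    have h0 : 0 < s / (2 ^ j)%:R by rewrite divr_gt0// ltr0n expn_gt0.
    have rh0 : 0 <= r / (s / (2 ^ j)%:R) by rewrite divr_ge0// ltW.
    have := truncn_itv rh0; set i := Num.truncn _ => /andP[i1 i2].
    exists i.
      rewrite -(ler_nat R); apply: (le_trans i1).
      by rewrite ler_pdivrMr// mesh_mul.
    by rewrite -ler_pdivlMr// i1/= -ler_pdivrMr// ltW.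
  set h := s / _ in hj gj *.
  move=> [i ij /andP[ir ri]].
  have h0 : 0 <= h by exact: mesh_ge0.
  have := gj _ ij; have := err _ _ ij; rewrite -/h => e1 e2.
  have := unit_telegraph_lipschitz (count_nd w) (mulr_ge0 (ler0n R i) h0) ir.
  rewrite ler_norml => /andP[l1 _].
  move: ri; rewrite -natr1 mulrDl mul1r; move: hj; rewrite mulrDl mul1r.
  lra.
apply/ler_addgt0Pr => e e0.
have [j hj] := mesh_small (4 * n%:R) s0 e0.
have [_ /(_ j (leqnn j)) /= [_ gj]] := gw j I.
have := err _ _ (leqnn (2 ^ j)); rewrite mesh_mul; lra.
Qed.

Let measurable_grid_surviving n s x m : 0 <= s ->
  process_sigma_algebra count (grid_surviving n s x m).
Proof.
move=> s0.
have mr h i a : 0 <= h -> process_sigma_algebra count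
    [set w | a <= riemann_telegraph (fun s => count s w) h i].
  move=> h0; have := @measurable_riemann_telegraph h i h0 measurableT `[a, +oo[%classic.
  rewrite setTI => /(_ (measurable_itv _)).
  congr (process_sigma_algebra _ _).
  by apply/seteqP; split=> w /=; rewrite in_itv/= andbT.
pose E j := \bigcap_(i in [set i | (i <= 2 ^ j)%N]) [set w |
    - (2 * (s / (2 ^ j)%:R) * n%:R) <= riemann_telegraph (fun s => count s w) (s / (2 ^ j)%:R) i]
  `&` [set w | x - 2 * (s / (2 ^ j)%:R) * n%:R <=
               riemann_telegraph (fun s => count s w) (s / (2 ^ j)%:R) (2 ^ j)].
have -> : grid_surviving n s x m = (count s @^-1` [set n]) `&`
    \bigcap_(j in [set j | (j <= m)%N]) E j.
  apply/seteqP; split=> [w [Nw g]|w [Nw g]].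
    split => // j jm; have [g1 g2] := g j jm; split => //.
  by split => // j jm h; have [g1 g2] := g j jm; split.
have mE j : @measurable _ pT (E j).
  apply: (@measurableI _ pT); last by apply: mr; exact: mesh_ge0.
  by apply: (@bigcap_measurableType _ pT) => i _; apply: mr; exact: mesh_ge0.
apply: (@measurableI _ pT).
  by rewrite -[X in measurable X]setTI; exact: measurable_count.
by apply: (@bigcap_measurableType _ pT) => j _; exact: mE.
Qed.

Lemma measurable_surviving n s x : 0 <= s ->
  process_sigma_algebra count (surviving n s x).
Proof.
move=> s0; rewrite surviving_grid//.
by apply: (@bigcapT_measurable _ pT) => m; exact: measurable_grid_surviving.
Qed.

(** The product rule holds for each grid event, and both sides pass to the limit by continuity from
    above. *)
Lemma surviving_independent n s u x (B : set nat) : 0 <= s -> s <= u ->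
  P (surviving n s x `&` inc s u @^-1` B) =
  (P (surviving n s x) * P (inc s u @^-1` B))%E.
Proof.
move=> s0 su.
have mg m : measurable (grid_surviving n s x m).
  by apply: process_sigma_algebra_measurable; exact: measurable_grid_surviving.
have nig : nonincreasing_seq (grid_surviving n s x).
  apply/nonincreasing_seqP => m; apply/subsetPset => w [Nw g]; split => // j jm.
  by apply: g; exact: leqW.
have gP m : P (grid_surviving n s x m `&` inc s u @^-1` B) =
    (P (grid_surviving n s x m) * P (inc s u @^-1` B))%E.
  have := @grid_determined_independent (s / (2 ^ m)%:R) (2 ^ m) u
    (grid_surviving n s x m) B (mesh_ge0 m s0).
  rewrite mesh_mul => /(_ su); apply => //.
  move=> w w' ww' [Nw g].
  have ww'j j i : (j <= m)%N -> (i <= 2 ^ j)%N ->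
      N (i%:R * (s / (2 ^ j)%:R)) w' = N (i%:R * (s / (2 ^ j)%:R)) w.
    move=> jm ij.
    (* Dyadic grids are nested, so all levels j <= m are read on the grid of level m. *)
    have -> : i%:R * (s / (2 ^ j)%:R) = (i * 2 ^ (m - j))%:R * (s / (2 ^ m)%:R).
      rewrite -{2}(subnK jm) expnD !natrM; field.
      by rewrite !pnatr_eq0 -!lt0n !expn_gt0.
    rewrite ww'//; apply: leq_trans (leq_mul ij (leqnn _)) _.
    by rewrite -expnD subnKC.
  have rE j i : (j <= m)%N -> (i <= 2 ^ j)%N ->
      riemann_telegraph (fun s => count s w') (s / (2 ^ j)%:R) i =
      riemann_telegraph (fun s => count s w) (s / (2 ^ j)%:R) i.
    move=> jm ij; apply: eq_bigr => l _.
    by rewrite ww'j// (leq_trans _ ij)// ltnW.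
  split; first by have := ww' _ (leqnn _); rewrite mesh_mul => <-.
  move=> j jm h; have [g1 g2] := g _ jm; split=> [i ij|]; rewrite rE//; exact: g1.
have fP E : measurable E -> P E \is a fin_num by move=> mE; exact: fin_num_measure.
have c1 : P (grid_surviving n s x m `&` inc s u @^-1` B) @[m --> \oo] -->
    P (surviving n s x `&` inc s u @^-1` B).
  have -> : surviving n s x `&` inc s u @^-1` B =
      \bigcap_m (grid_surviving n s x m `&` inc s u @^-1` B).
    rewrite surviving_grid//; apply/seteqP; split=> [w [gw Bw] m _|w gw].
      by split => //; exact: gw.
    by split=> [m _|]; [case: (gw m I)|case: (gw 0%N I)].
  apply: nonincreasing_cvg_mu.
  - by rewrite ltey_eq fP//; exact: measurableI.
  - by move=> m; exact: measurableI.
  - by apply: bigcapT_measurable => m; exact: measurableI.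
  - by move=> k l kl; apply/subsetPset; apply: setSI; apply/subsetPset; exact: nig.
have c2 : P (grid_surviving n s x m `&` inc s u @^-1` B) @[m --> \oo] -->
    (P (surviving n s x) * P (inc s u @^-1` B))%E.
  under eq_fun do rewrite gP.
  rewrite -(fineK (fP _ (measurable_inc s u B))).
  apply: cvgeZr => //.
  rewrite surviving_grid//; apply: nonincreasing_cvg_mu => //.
  - by rewrite ltey_eq fP.
  - exact: bigcapT_measurable.
exact: (cvg_unique _ c1 c2).
Qed.

End poisson_telegraph.

(** * Probability of the survival events *)

Section surviving_probability.
Context (R : realType) d (Omega : measurableType d) (P : probability Omega R).
Context (lambda : R) (N : R -> {RV P >-> nat}).
Hypothesis lambda_gt0 : 0 < lambda.
Hypothesis N_poisson : is_poisson_process lambda N.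

Local Notation count := (fun s => N s : Omega -> nat).
Local Notation S w := (unit_telegraph (fun s => count s w)).
Local Notation inc s u := (increment count s u).
Local Notation surv n s x := (surviving N n s x).

Let count_nd w (s u : R) : 0 <= s -> s <= u -> (N s w <= N u w)%N.
Proof. exact: (poisson_process_nondecreasing N_poisson). Qed.

Let count0 w : N 0 w = 0%N.
Proof. exact: (poisson_process_start N_poisson). Qed.

Let measurable_surv n s x : 0 <= s -> measurable (surv n s x).
Proof.
move=> s0; apply: (process_sigma_algebra_measurable (N := N)).
exact: measurable_surviving N_poisson _ _ _ s0.
Qed.

Let measurable_inc s u B : measurable (inc s u @^-1` B).
Proof. exact: (measurable_increment N). Qed.

Let pr (E : set Omega) : R := fine (P E).

Let prE E : measurable E -> P E = (pr E)%:E.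
Proof. by move=> mE; rewrite /pr fineK// fin_num_measure. Qed.

Lemma increment_prob (s h : R) k : 0 <= s -> 0 < h ->
  pr (inc s (s + h) @^-1` [set k]) =
  (lambda * h) ^+ k / k`!%:R * expR (- (lambda * h)).
Proof.
move=> s0 h0; rewrite /pr (poisson_process_increment_law N_poisson)//; last first.
  by rewrite ltrDl.
by rewrite [s + h]addrC addrK /poisson_pmf mulr_gt0.
Qed.

(** With a = lambda h, the probability is 1 - (1 + a)e^(-a) <= 1 - (1 + a)(1 - a) = a^2. *)
Lemma increment_ge2_prob (s h : R) : 0 <= s -> 0 < h ->
  pr (inc s (s + h) @^-1` [set k | (1 < k)%N]) <= (lambda * h) ^+ 2.
Proof.
move=> s0 h0.
have -> : inc s (s + h) @^-1` [set k | (1 < k)%N] =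
    ~` (inc s (s + h) @^-1` [set 0%N] `|` inc s (s + h) @^-1` [set 1%N]).
  apply/seteqP; split=> w /=; first by move=> i1 [] i; rewrite i in i1.
  by move/not_orP => []; case: (inc _ _ w) => [|[|]].
rewrite {1}/pr probability_setC; last exact: measurableU.
rewrite measureU//; last by apply/seteqP; split=> // w [/= ->].
rewrite (_ : (1 - _)%E = (1 - (pr (inc s (s + h) @^-1` [set 0%N]) +
    pr (inc s (s + h) @^-1` [set 1%N])))%:E); last first.
  by rewrite EFinB EFinD; congr (1 - (_ + _))%E; exact: prE.
rewrite !increment_prob// expr0 expr1 fact0 (_ : 1`! = 1%N)// !divr1 mul1r /=.
set a := lambda * h.
have a0 : 0 < a by rewrite mulr_gt0.
have : 1 - a <= expR (- a) by apply: le_trans (expR_ge1Dx _).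
rewrite expr2; nra.
Qed.

Let surviving_increment_prob n s h x k : 0 <= s -> 0 < h ->
  P (surv n s x `&` inc s (s + h) @^-1` [set k]) =
  (pr (surv n s x) * ((lambda * h) ^+ k / k`!%:R * expR (- (lambda * h))))%:E.
Proof.
move=> s0 h0; rewrite -(increment_prob k s0 h0).
rewrite (surviving_independent N_poisson) ?lerDl ?(ltW h0)// EFinM -!prE//.
exact: measurable_surv.
Qed.

(** The three events correspond to 0, 1 and at least 2 jumps; independence factors the first two,
    and the last is of order h^2. *)
Lemma surviving_step_le E n m s h x y : measurable E -> 0 <= s -> 0 < h ->
  E `<=` (surv n s x `&` inc s (s + h) @^-1` [set 0%N]) `|`
         (surv m s y `&` inc s (s + h) @^-1` [set 1%N]) `|`
         inc s (s + h) @^-1` [set k | (1 < k)%N] ->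
  pr E <= expR (- (lambda * h)) * (pr (surv n s x) + lambda * h * pr (surv m s y))
          + (lambda * h) ^+ 2.
Proof.
move=> mE s0 h0 sub; rewrite -lee_fin -prE//.
have sh : s <= s + h by rewrite lerDl ltW.
pose A := surv n s x `&` inc s (s + h) @^-1` [set 0%N].
pose B := surv m s y `&` inc s (s + h) @^-1` [set 1%N].
pose C := inc s (s + h) @^-1` [set k | (1 < k)%N].
have mA : measurable A by apply: measurableI => //; exact: measurable_surv.
have mB : measurable B by apply: measurableI => //; exact: measurable_surv.
have mC : measurable C by exact: measurable_inc.
have mAB : measurable (A `|` B) by exact: measurableU.
apply: (@le_trans _ _ (P A + P B + P C)%E).
  apply: (@le_trans _ _ (P (A `|` B `|` C))).
    by apply: le_measure; rewrite ?inE//; exact: measurableU.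
  apply: (le_trans (measureU2 _ _ _)) => //.
  by rewrite leeD2r// measureU2.
rewrite /A /B !surviving_increment_prob// (prE mC) -!EFinD lee_fin.
rewrite expr0 expr1 fact0 (_ : 1`! = 1%N)// !divr1 mul1r.
apply: lerD; last exact: increment_ge2_prob.
by rewrite le_eqVlt; apply/orP; left; apply/eqP; ring.
Qed.

Lemma surviving_step_ge E n m s h x y : measurable E -> 0 <= s -> 0 < h ->
  (surv n s x `&` inc s (s + h) @^-1` [set 0%N]) `<=` E ->
  (surv m s y `&` inc s (s + h) @^-1` [set 1%N]) `<=` E ->
  expR (- (lambda * h)) * (pr (surv n s x) + lambda * h * pr (surv m s y)) <= pr E.
Proof.
move=> mE s0 h0 sA sB; rewrite -lee_fin -prE//.
have sh : s <= s + h by rewrite lerDl ltW.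
pose A := surv n s x `&` inc s (s + h) @^-1` [set 0%N].
pose B := surv m s y `&` inc s (s + h) @^-1` [set 1%N].
have mA : measurable A by apply: measurableI => //; exact: measurable_surv.
have mB : measurable B by apply: measurableI => //; exact: measurable_surv.
have mAB : measurable (A `|` B) by exact: measurableU.
apply: (@le_trans _ _ (P A + P B)%E); last first.
  have <- : P (A `|` B) = (P A + P B)%E.
    by apply: measureU => //; apply/seteqP; split=> // w [[_ /= i0] [_ /=]]; rewrite i0.
  by apply: le_measure; rewrite ?inE// => w [/sA|/sB].
rewrite /A /B !surviving_increment_prob// -!EFinD lee_fin.
rewrite expr0 expr1 fact0 (_ : 1`! = 1%N)// !divr1 mul1r.
by rewrite le_eqVlt; apply/orP; left; apply/eqP; ring.
Qed.

Let norm_le (a b : R) : `|a| <= b -> a <= b /\ - b <= a.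
Proof. by rewrite ler_norml => /andP[]. Qed.

Let S_lip w a b : 0 <= a -> a <= b -> S w b - S w a <= b - a /\ - (b - a) <= S w b - S w a.
Proof.
move=> a0 ab; apply: norm_le; apply: unit_telegraph_lipschitz => // u v.
exact: count_nd.
Qed.

Let S_le w s : 0 <= s -> S w s <= s.
Proof.
by move=> s0; have [] := S_lip w (lexx 0) s0; rewrite unit_telegraph0 !subr0.
Qed.

Let inc0 w s h : 0 <= s -> 0 <= h -> inc s (s + h) w = 0%N -> N (s + h) w = N s w.
Proof.
move=> s0 h0 /eqP; rewrite subn_eq0 => i0; apply/eqP; rewrite eqn_leq i0.
by apply: count_nd => //; rewrite lerDl.
Qed.

Let incE w s h : 0 <= s -> 0 <= h -> N (s + h) w = (N s w + inc s (s + h) w)%N.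
Proof. by move=> s0 h0; rewrite subnKC// count_nd// lerDl. Qed.

Let S_const w s h r : 0 <= s -> N (s + h) w = N s w -> s <= r -> r <= s + h ->
  S w r = S w s + (- 1) ^+ N s w * (r - s).
Proof.
move=> s0 Nh sr rh; rewrite (unit_telegraph_cst (count_nd w) s0 sr)//.
by apply/eqP; rewrite eqn_leq (count_nd w s0 sr) -Nh count_nd// (le_trans s0 sr).
Qed.

(** The final motion is upwards. Speed at most 1 forces S(s) >= x for any arrival above x + h, with
    or without jump. For the lower bound with one jump, height h at time s keeps the path
    nonnegative, and height x + 2h secures the arrival. *)
Lemma surviving_even_step n s h x : odd n -> 0 <= s -> 0 < h ->
  expR (- (lambda * h)) *
    (pr (surv n.+1 s x) + lambda * h * pr (surv n s (Num.max (x + 2 * h) h))) <=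
  pr (surv n.+1 (s + h) (x + h)) <=
  expR (- (lambda * h)) * (pr (surv n.+1 s x) + lambda * h * pr (surv n s x)) +
    (lambda * h) ^+ 2.
Proof.
move=> on s0 h0; have h0' := ltW h0.
have sh : s <= s + h by rewrite lerDl.
have sh0 : 0 <= s + h by rewrite addr_ge0.
have up w : N s w = n.+1 -> (- 1) ^+ N s w = 1 :> R.
  by move=> ->; rewrite -signr_odd/= on.
apply/andP; split.
- apply: surviving_step_ge => //; first exact: measurable_surv.
  + move=> w [[Nw S0 Sx] /= i0]; have N' := inc0 s0 h0' i0.
    have Sr r : s <= r -> r <= s + h -> S w r = S w s + (r - s).
      by move=> sr rh; rewrite (S_const s0 N' sr rh) up// mul1r.
    split; first by rewrite N'.
      move=> r /andP[r0 rh]; have [rs|sr] := leP r s; first by rewrite S0// r0.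
      rewrite Sr ?(ltW sr)//; have := S0 s; rewrite s0 lexx => /(_ isT); lra.
    by rewrite Sr//; lra.
  + move=> w [[Nw S0 Sx] /= i1]; have N' := incE w s0 h0'.
    move: Sx; rewrite ge_max => /andP[Sx Sh].
    split; first by rewrite N' i1 Nw addn1.
      move=> r /andP[r0 rh]; have [rs|sr] := leP r s; first by rewrite S0// r0.
      by have [] := S_lip w s0 (ltW sr); lra.
    by have [] := S_lip w s0 sh; lra.
- apply: surviving_step_le => //; first exact: measurable_surv.
  move=> w [Nw S0 Sx]; have N' := incE w s0 h0'.
  have S0' r : 0 <= r <= s -> 0 <= S w r.
    by move=> /andP[r0 rs]; apply: S0; rewrite r0 (le_trans rs).
  case i : (inc s (s + h) w) => [|[|k]]; last by right; rewrite /= i.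
    left; left; split => //.
    have N'' := inc0 s0 h0' i; split => //; first by rewrite -N''.
    move: Sx; rewrite (S_const s0 N'' sh (lexx _)) up; last by rewrite -N''.
    lra.
  left; right; split => //; split => //.
    by move: N'; rewrite Nw i addn1 => -[].
  by have [] := S_lip w s0 sh; lra.
Qed.

(** The final motion is downwards, so without jump a final height at least x >= 0 already gives
    nonnegativity during the step. With one jump the displacement is at most h: height x + h
    suffices and height x - h is necessary. *)
Lemma surviving_odd_step n s h x : ~~ odd n -> 0 <= s -> 0 < h -> 0 <= x ->
  expR (- (lambda * h)) *
    (pr (surv n.+1 s (x + h)) + lambda * h * pr (surv n s (x + h))) <=
  pr (surv n.+1 (s + h) x) <=
  expR (- (lambda * h)) *
    (pr (surv n.+1 s (x + h)) + lambda * h * pr (surv n s (x - h))) +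
    (lambda * h) ^+ 2.
Proof.
move=> en s0 h0 x0; have h0' := ltW h0.
have sh : s <= s + h by rewrite lerDl.
have sh0 : 0 <= s + h by rewrite addr_ge0.
have down w : N s w = n.+1 -> (- 1) ^+ N s w = - 1 :> R.
  by move=> ->; rewrite -signr_odd/= en.
apply/andP; split.
- apply: surviving_step_ge => //; first exact: measurable_surv.
  + move=> w [[Nw S0 Sx] /= i0]; have N' := inc0 s0 h0' i0.
    have Sr r : s <= r -> r <= s + h -> S w r = S w s - (r - s).
      by move=> sr rh; rewrite (S_const s0 N' sr rh) down// mulN1r.
    split; first by rewrite N'.
      move=> r /andP[r0 rh]; have [rs|sr] := leP r s; first by rewrite S0// r0.
      by rewrite Sr ?(ltW sr)//; lra.
    by rewrite Sr//; lra.
  + move=> w [[Nw S0 Sx] /= i1]; have N' := incE w s0 h0'.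
    split; first by rewrite N' i1 Nw addn1.
      move=> r /andP[r0 rh]; have [rs|sr] := leP r s; first by rewrite S0// r0.
      by have [] := S_lip w s0 (ltW sr); lra.
    by have [] := S_lip w s0 sh; lra.
- apply: surviving_step_le => //; first exact: measurable_surv.
  move=> w [Nw S0 Sx]; have N' := incE w s0 h0'.
  have S0' r : 0 <= r <= s -> 0 <= S w r.
    by move=> /andP[r0 rs]; apply: S0; rewrite r0 (le_trans rs).
  case i : (inc s (s + h) w) => [|[|k]]; last by right; rewrite /= i.
    left; left; split => //.
    have N'' := inc0 s0 h0' i; split => //; first by rewrite -N''.
    move: Sx; rewrite (S_const s0 N'' sh (lexx _)) down; last by rewrite -N''.
    lra.
  left; right; split => //; split => //.
    by move: N'; rewrite Nw i addn1 => -[].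
  by have [] := S_lip w s0 sh; lra.
Qed.

Lemma surviving_no_jump s x : 0 <= s -> 0 <= x <= s ->
  pr (surv 0 s x) = expR (- (lambda * s)).
Proof.
move=> s0 /andP[x0 xs].
have -> : surv 0 s x = count s @^-1` [set 0%N].
  apply/seteqP; split=> [w []//|w /= Nw].
  have Sr r : 0 <= r -> r <= s -> S w r = r.
    move=> r0 rs; have := @S_const w 0 s r (lexx 0).
    by rewrite add0r count0 Nw unit_telegraph0 expr0 mul1r add0r subr0; exact.
  split => // [r /andP[r0 rs]|]; first by rewrite Sr.
  by rewrite Sr.
(* The law of an increment is prescribed only over intervals of positive length, hence the separate
   case s = 0. *)
move: s0 {x x0 xs}; rewrite le_eqVlt => /predU1P[<-|s0].
  rewrite (_ : count 0 @^-1` _ = setT); last first.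
    by apply/seteqP; split=> w //= _; exact: count0.
  by rewrite /pr probability_setT mulr0 oppr0 expR0.
have := @increment_prob 0 s 0 (lexx _) s0.
rewrite expr0 fact0 divr1 mul1r add0r => <-; congr pr.
by apply/seteqP; split=> w /=; rewrite /increment count0 subn0.
Qed.

Lemma surviving_prob n s x : 0 <= x <= s ->
  P (surv n s x) =
  (expR (- (lambda * s)) * (lambda ^+ n * survival_coef n s x))%:E.
Proof.
move=> xs; have s0 : 0 <= s by case/andP: xs => /le_trans; apply.
rewrite prE; last exact: measurable_surv.
congr EFin.
pose G n s x := expR (lambda * s) / lambda ^+ n * pr (surv n s x).
have ln0 m : 0 < lambda ^+ m by exact: exprn_gt0.
suff : G n s x = survival_coef n s x.
  move=> <-; rewrite /G; have := ln0 n; set l := lambda ^+ n => l0.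
  rewrite expRN; field; rewrite gt_eqF//= gt_eqF//; exact: expR_gt0.
have pr_ge0 E : 0 <= pr E by rewrite fine_ge0.
have pr_le1 m u y : 0 <= u -> pr (surv m u y) <= 1.
  by move=> u0; rewrite -lee_fin -prE ?probability_le1//; exact: measurable_surv.
have coef_ge0 m u : 0 <= expR (lambda * u) / lambda ^+ m.
  by rewrite divr_ge0// ?expR_ge0// ltW.
(* The recursion is run with horizon s, so exp(lambda s) dominates every normalizing factor; in [C]
   the extra lambda^2 comes from (lambda h)^2. *)
pose B n := expR (lambda * s) / lambda ^+ n.
pose C n := expR (lambda * s) / lambda ^+ n * lambda ^+ 2.
have step m a h p q r e : 0 <= a -> 0 <= h -> a + h <= s ->
    0 <= e ->
    p <= expR (- (lambda * h)) * (q + lambda * h * r) + (lambda * h) ^+ 2 * e ->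
    expR (lambda * (a + h)) / lambda ^+ m.+1 * p <=
    expR (lambda * a) / lambda ^+ m.+1 * q + h * (expR (lambda * a) / lambda ^+ m * r) +
    C m.+1 * h ^+ 2 * e.
  move=> a0 h0 ahs e0 pq.
  apply: (le_trans (ler_wpM2l (coef_ge0 _ _) pq)).
  rewrite mulrDr; apply: lerD.
    rewrite mulrDr expRD expRN exprS; have := ln0 m; set l := lambda ^+ m => l0.
    rewrite le_eqVlt; apply/orP; left; apply/eqP; field.
    by rewrite !gt_eqF// expR_gt0.
  rewrite exprMn /C; set l := lambda ^+ m.+1.
  rewrite [X in _ <= X](_ : _ = expR (lambda * s) / l * (lambda ^+ 2 * h ^+ 2 * e)); last by ring.
  apply: ler_wpM2r; first by rewrite !mulr_ge0 ?exprn_ge0// ltW.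
  apply: ler_wpM2r; first by rewrite invr_ge0 /l ltW.
  by rewrite ler_expR ler_wpM2l// ltW.
have step' m a h p q r :
    expR (- (lambda * h)) * (q + lambda * h * r) <= p ->
    expR (lambda * a) / lambda ^+ m.+1 * q + h * (expR (lambda * a) / lambda ^+ m * r) <=
    expR (lambda * (a + h)) / lambda ^+ m.+1 * p.
  move=> pq; apply: le_trans (ler_wpM2l (coef_ge0 _ _) pq).
  rewrite (mulrDr lambda) expRD expRN exprS; have := ln0 m; set l := lambda ^+ m => l0.
  rewrite le_eqVlt; apply/orP; left; apply/eqP; field.
  by rewrite !gt_eqF// expR_gt0.
apply: (@survival_recursion_unique _ s G B C) => //.
- by move=> m; rewrite /C mulr_ge0// exprn_ge0// ltW.
- by move=> m u y; rewrite mulr_ge0.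
- move=> m u y /andP[u0 us]; rewrite /G /B.
  apply: (@le_trans _ _ (expR (lambda * u) / lambda ^+ m)).
    by rewrite ler_piMr// pr_le1.
  by apply: ler_wpM2r; [rewrite invr_ge0 ltW|rewrite ler_expR ler_wpM2l// ltW].
- move=> m u y u0 y0; rewrite /G; congr (_ * pr _).
  apply/seteqP; split=> w [Nw S0 Sx]; split=> //.
    by apply: S0; rewrite u0 lexx.
  exact: le_trans Sx.
- move=> m u y u0 uy; rewrite /G (_ : surv m u y = set0).
    by rewrite /pr measure0 mulr0.
  apply/seteqP; split=> // w [_ _]; rewrite leNgt => /negP; apply.
  exact: le_lt_trans (S_le w u0) uy.
- move=> m y; rewrite /G (_ : surv m.+1 0 y = set0).
    by rewrite /pr measure0 mulr0.
  by apply/seteqP; split=> // w []; rewrite count0.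
- move=> u y /andP[u0 us] yu; rewrite /G surviving_no_jump//.
  by rewrite expr0 divr1 -expRD subrr expR0.
- move=> m a h y om a0; rewrite le_eqVlt => /predU1P[<-|h0] ahs.
    by rewrite !addr0 !mul0r expr0n mulr0 !addr0 lexx.
  have /andP[lo hi] := surviving_even_step y om a0 h0.
  apply/andP; split; first exact: step'.
  have := @step m a h _ _ _ 1 a0 (ltW h0) ahs ler01.
  by rewrite !mulr1; apply.
- move=> m a h y om a0; rewrite le_eqVlt => /predU1P[<-|h0] ahs y0.
    by rewrite !addr0 !mul0r expr0n mulr0 !addr0 lexx.
  have /andP[lo hi] := surviving_odd_step om a0 h0 y0.
  apply/andP; split; first exact: step'.
  have := @step m a h _ _ _ 1 a0 (ltW h0) ahs ler01.
  by rewrite !mulr1; apply.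
Qed.

End surviving_probability.

(** * Gamma and Bessel functions *)

Section is_derive_fun.
Context (R : realType).
Implicit Types (f g : R -> R) (x a b : R).

Lemma is_derive_mul_fun f g x a b : is_derive x 1 f a -> is_derive x 1 g b ->
  is_derive x 1 (fun y => f y * g y) (a * g x + f x * b).
Proof.
move=> Df Dg; have -> : (fun y => f y * g y) = f * g by apply/funext.
by apply: (is_derive_eq (is_deriveM Df Dg)); rewrite /GRing.scale/=; ring.
Qed.

Lemma is_derive_exprn_fun f x a n : is_derive x 1 f a ->
  is_derive x 1 (fun y => f y ^+ n) (n%:R * f x ^+ n.-1 * a).
Proof.
move=> Df; have -> : (fun y => f y ^+ n) = f ^+ n.
  by apply/funext => y; rewrite exprfctE.
exact: is_deriveX.
Qed.

End is_derive_fun.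

Section gamma_factorial.
Context (R : realType).

(** The bound e^x >= x^(k+1) / (k+1)! makes the product at most (k+1)! / x. *)
Lemma cvg_exprn_expRN (k : nat) : x ^+ k * expR (- x) @[x --> +oo%R] --> (0 : R).
Proof.
apply/cvgrPdist_le => e e0; near=> x.
have x0 : 0 < x by near: x; exact: nbhs_pinfty_gt.
have xe : k.+1`!%:R / e <= x by near: x; apply: nbhs_pinfty_ge; exact: num_real.
rewrite sub0r normrN ger0_norm ?mulr_ge0 ?exprn_ge0 ?expR_ge0 ?(ltW x0)//.
have f0 : 0 < k.+1`!%:R :> R by rewrite ltr0n fact_gt0.
have := @expR_ge1Dxn R x k (ltW x0) => ex.
have {}ex : x ^+ k.+1 / k.+1`!%:R <= expR x by apply: le_trans ex; rewrite lerDr.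
rewrite expRN ler_pdivrMr ?expR_gt0//.
apply: le_trans (ler_wpM2l (ltW e0) ex).
rewrite mulrA ler_pdivlMr// exprS.
move: xe; rewrite ler_pdivrMr// => xe.
have := ler_wpM2l (exprn_ge0 k (ltW x0)) xe; lra.
Unshelve. all: by end_near. Qed.

Lemma is_derive_expRN (x : R) : is_derive x 1 (fun y : R => expR (- y)) (- expR (- x)).
Proof. by apply: is_derive_eq; rewrite /GRing.scale/=; ring. Qed.

(** The recursion is integration by parts, for the antiderivative of x^k e^(-x) that vanishes at
    infinity. *)
Fixpoint gamma_primitive (k : nat) (x : R) : R :=
  if k is k'.+1 then - (x ^+ k * expR (- x)) + k%:R * gamma_primitive k' x
  else - expR (- x).

Lemma is_derive_gamma_primitive (k : nat) (x : R) :
  is_derive x 1 (gamma_primitive k) (x ^+ k * expR (- x)).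
Proof.
elim: k => [|k IH].
  by apply: is_derive_eq; rewrite expr0 /GRing.scale/=; ring.
have -> : gamma_primitive k.+1 =
  (fun x => - (x ^+ k.+1 * expR (- x))) + (k.+1%:R *: gamma_primitive k).
  by apply/funext.
have D1 := is_deriveN (is_derive_mul_fun
  (is_derive_exprn_fun k.+1 (is_derive_id x 1)) (is_derive_expRN x)).
have D2 : is_derive x 1 (k.+1%:R *: gamma_primitive k)
    (k.+1%:R *: (x ^+ k * expR (- x))) by exact: is_deriveZ.
by apply: (is_derive_eq (is_deriveD D1 D2)); rewrite /GRing.scale/= exprS; ring.
Qed.

Lemma cvg_gamma_primitive k : gamma_primitive k x @[x --> +oo%R] --> (0 : R).
Proof.
elim: k => [|k IH] /=.
  by rewrite -oppr0; apply: cvgN; have := cvg_exprn_expRN 0; under eq_fun do rewrite expr0 mul1r.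
rewrite -[0]addr0; apply: cvgD.
  by rewrite -oppr0; apply: cvgN; exact: cvg_exprn_expRN.
by rewrite -[X in _ --> X](mulr0 k.+1%:R); apply: cvgM => //; exact: cvg_cst.
Qed.

Lemma gamma_primitive0 k : gamma_primitive k 0 = - k`!%:R.
Proof.
elim: k => [|k IH] /=; first by rewrite oppr0 expR0.
by rewrite IH expr0n/= mul0r oppr0 add0r factS natrM mulrN.
Qed.

Lemma Gamma_nat (k : nat) : Gamma (k%:R + 1 : R) = k`!%:R.
Proof.
rewrite /Gamma.
have cF (G : R -> R) (dG : forall x : R, derivable G x 1) : continuous G.
  move=> x; apply: differentiable_continuous; exact/derivable1_diffP.
have cf : continuous (fun x : R => x ^+ k * expR (- x)).
  apply: (cF _ _); move=> x.
  by have [] := is_derive_mul_fun (is_derive_exprn_fun k (is_derive_id x 1)) (is_derive_expRN x).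
transitivity (\int[lebesgue_measure]_(x in `]0, +oo[) (x ^+ k * expR (- x)) : R).
  apply: eq_Rintegral => x; rewrite inE/= in_itv/= andbT => x0.
  by rewrite addrK powR_mulrn// ltW.
rewrite /Rintegral integral_itv_obnd_cbnd; last first.
  apply/measurable_EFinP/measurable_funTS.
  exact: continuous_measurable_fun.
rewrite -/(Rintegral _ _ _).
rewrite (@Rintegral_ge0_continuous_FTC2y _ _ (gamma_primitive k) 0 0).
- by rewrite gamma_primitive0 sub0r opprK.
- by move=> x x0; rewrite mulr_ge0 ?exprn_ge0 ?expR_ge0.
- exact: continuous_subspaceT.
- exact: cvg_gamma_primitive.
- by move=> x _; have [] := is_derive_gamma_primitive k x.
- apply: cvg_at_right_filter; apply: (cF _ _); move=> x.
  by have [] := is_derive_gamma_primitive k x.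
- by move=> x _; rewrite derive1E; have [_ ->] := is_derive_gamma_primitive k x.
Qed.

End gamma_factorial.

Section bessel.
Context (R : realType).

Definition bessel_term (nu : nat) (x : R) (k : nat) : R :=
  (x / 2) ^+ (2 * k + nu) / (k`!%:R * (nu + k)`!%:R).

Lemma bessel_term_ge0 nu x k : 0 <= x -> 0 <= bessel_term nu x k.
Proof. by move=> x0; rewrite divr_ge0 ?exprn_ge0 ?mulr_ge0// divr_ge0. Qed.

(** Since (nu + k)! >= 1, the terms are dominated by (x/2)^nu times the exponential series at
    (x/2)^2. *)
Lemma cvg_bessel nu (x : R) : 0 <= x ->
  series (bessel_term nu x) @ \oo --> bessel_I nu x.
Proof.
move=> x0.
have -> : bessel_I nu x = limn (series (bessel_term nu x)).
  congr (limn (series _)); apply/funext => k.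
  by rewrite /bessel_term -natrD Gamma_nat.
pose v k := (x / 2) ^+ nu * exp_coeff ((x / 2) ^+ 2) k.
have x2 : 0 <= x / 2 by rewrite divr_ge0.
suff : cvgn (series (bessel_term nu x)) by [].
apply: (@series_le_cvg _ _ v) => [k|k|k|].
- exact: bessel_term_ge0.
- by rewrite /v /exp_coeff !mulr_ge0 ?exprn_ge0.
- rewrite /bessel_term /v /exp_coeff/= exprD exprM.
  set p := _ ^+ k; set q := _ ^+ nu.
  have -> : p * q / (k`!%:R * (nu + k)`!%:R) = q * (p / k`!%:R) * ((nu + k)`!%:R)^-1.
    by rewrite invfM; ring.
  rewrite ler_piMr ?mulr_ge0 ?exprn_ge0//.
  by rewrite invf_le1 ?ltr0n ?fact_gt0// ler1n fact_gt0.
rewrite /v (_ : series _ = (fun n => (x / 2) ^+ nu * series (exp_coeff ((x / 2) ^+ 2)) n)).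
  by apply: is_cvgM; [exact: is_cvg_cst|exact: is_cvg_series_exp_coeff].
by apply/funext => n; rewrite /series/= mulr_sumr.
Qed.

Lemma bessel_ge0 nu (x : R) : 0 <= x -> 0 <= bessel_I nu x.
Proof.
move=> x0; have c := @cvg_bessel nu x x0.
rewrite -(cvg_lim (@Rhausdorff R) c); apply: limr_ge; first by apply/cvg_ex; eexists; exact: c.
by apply: nearW => n; apply: sumr_ge0 => k _; exact: bessel_term_ge0.
Qed.

Lemma bessel0_ge1 (x : R) : 0 <= x -> 1 <= bessel_I 0 x.
Proof.
move=> x0; have c := @cvg_bessel 0 x x0.
rewrite -(cvg_lim (@Rhausdorff R) c); apply: limr_ge; first by apply/cvg_ex; eexists; exact: c.
near=> n; rewrite /series/=.
have n0 : (0 < n)%N by near: n; exists 1%N.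
rewrite big_ltn// /bessel_term expr0 fact0 mulr1 divr1 lerDl.
by apply: sumr_ge0 => k _; exact: bessel_term_ge0.
Unshelve. all: by end_near. Qed.

(** Nonnegativity gives convergence in the extended reals, so the partial sums of even length
    determine the sum. Floor and ceiling of n/2 become explicit once consecutive jump counts are
    paired. *)
Lemma nneseries_pairs (f : nat -> R) (l : R) : (forall n, 0 <= f n) ->
  series (fun k => f k.*2 + f k.*2.+1) @ \oo --> l ->
  (\sum_(n <oo) (f n)%:E = l%:E)%E.
Proof.
move=> f0 fl.
have c1 : (\sum_(0 <= n < M) (f n)%:E)%E @[M --> \oo] --> (\sum_(n <oo) (f n)%:E)%E.
  by apply: is_cvg_nneseries => n _ _; rewrite lee_fin.
have c2 : (\sum_(0 <= n < M.*2) (f n)%:E)%E @[M --> \oo] --> (\sum_(n <oo) (f n)%:E)%E.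
  apply: (cvg_comp _ _ _ c1).
  move=> A [n _ nA]; exists n => // m /= nm; apply: nA => /=.
  by rewrite (leq_trans nm)// -addnn leq_addr.
have sE : (fun M => (\sum_(0 <= n < M.*2) (f n)%:E)%E) =
    EFin \o series (fun k => f k.*2 + f k.*2.+1).
  apply/funext => M /=; rewrite sumEFin; congr EFin; rewrite /series/=.
  elim: M => [|M IH]; first by rewrite !big_geq.
  by rewrite doubleS !big_nat_recr//= IH addrA.
rewrite sE in c2; apply: (cvg_unique (@ereal_hausdorff R) c2).
by apply/fine_cvgP; split; [exact: nearW|exact: fl].
Qed.

End bessel.

(** * The density as a power series *)

Section meander_density.
Context (R : realType) (lambda c t : R).
Hypotheses (lambda_gt0 : 0 < lambda) (c_gt0 : 0 < c) (t_gt0 : 0 < t).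

(** Minus the derivative of [survival_coef] in x. The truncated predecessors are harmless: an
    exponent 0 occurs there with the factor a or b equal to 0. *)
Definition survival_slope (n : nat) (s x : R) : R :=
  let a := n./2 in let b := uphalf n in
  let u := (s + x) / 2 in let v := (s - x) / 2 in
  (b%:R * u ^+ a * v ^+ b.-1 - a%:R * u ^+ a.-1 * v ^+ b) /
  (2 * (a`!%:R * b`!%:R)).

(** After extraction of common powers this is a v <= b u, which follows from a <= b and v <= u. *)
Lemma survival_slope_ge0 n s x : 0 <= x <= s -> 0 <= survival_slope n s x.
Proof.
case/andP => x0 xs; rewrite /survival_slope/= uphalf_half.
set u := (s + x) / 2; set v := (s - x) / 2.
have u0 : 0 <= u by rewrite /u; lra.
have v0 : 0 <= v by rewrite /v; lra.
have vu : v <= u by rewrite /u /v; lra.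
apply: divr_ge0 => //; rewrite subr_ge0.
case: n./2 => [|k]; first by rewrite !mul0r !mulr_ge0 ?exprn_ge0.
rewrite addnS /= !exprS; set m := (odd n + k)%N.
rewrite [X in X <= _](_ : _ = u ^+ k * v ^+ m * (k.+1%:R * v)); last by ring.
rewrite [X in _ <= X](_ : _ = u ^+ k * v ^+ m * (m.+1%:R * u)); last by ring.
apply: ler_wpM2l; first by rewrite mulr_ge0 ?exprn_ge0.
by apply: ler_pM => //; rewrite ler_nat ltnS leq_addl.
Qed.

Let is_derive_half (e x : R) :
  is_derive x 1 (fun y => (t + e * (y / c)) / 2) (e / (2 * c)).
Proof.
have -> : (fun y => (t + e * (y / c)) / 2) = cst (t / 2) + (e / (2 * c)) *: (id : R -> R).
  by apply/funext => y; rewrite -[RHS]/(t / 2 + e / (2 * c) * y); field; rewrite gt_eqF.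
apply: (is_derive_eq (is_deriveD (is_derive_cst (t / 2 : R) x 1)
  (is_deriveZ (e / (2 * c)) (is_derive_id x (1 : R))))).
by rewrite /GRing.scale/= add0r mulr1.
Qed.

Lemma is_derive_survival_coef n (x : R) :
  is_derive x 1 (fun y => - survival_coef n t (y / c)) (survival_slope n t (x / c) / c).
Proof.
pose a := n./2; pose b := uphalf n; pose D : R := a`!%:R * b`!%:R.
have D0 : D != 0 by rewrite mulf_neq0// pnatr_eq0 -lt0n fact_gt0.
have Du := is_derive_half 1 x; have Dv := is_derive_half (- 1) x.
have DM := is_derive_mul_fun (is_derive_exprn_fun a Du) (is_derive_exprn_fun b Dv).
have -> : (fun y => - survival_coef n t (y / c)) = (- D^-1) *:
    (fun y => ((t + 1 * (y / c)) / 2) ^+ a * ((t + - 1 * (y / c)) / 2) ^+ b).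
  apply/funext => y; rewrite /survival_coef -/a -/b -/D.
  rewrite -[RHS]/(- D^-1 * (((t + 1 * (y / c)) / 2) ^+ a * ((t + - 1 * (y / c)) / 2) ^+ b)).
  by rewrite mul1r mulN1r; ring.
apply: (is_derive_eq (is_deriveZ _ DM)).
rewrite /GRing.scale/= /survival_slope/= -/a -/b -/D mul1r mulN1r.
set p := _ ^+ a; set q := _ ^+ b; set p' := _ ^+ a.-1; set q' := _ ^+ b.-1.
by field; rewrite D0 gt_eqF.
Qed.

Lemma continuous_survival_slope n : continuous (fun x : R => survival_slope n t (x / c) / c).
Proof.
have cu (e : R) : continuous (fun y : R => (t + e * (y / c)) / 2).
  move=> x; apply: differentiable_continuous; apply/derivable1_diffP.
  by have [] := is_derive_half e x.
have cX (f : R -> R) k : continuous f -> continuous (fun y : R => f y ^+ k).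
  move=> cf x; apply: (@continuous_comp _ _ _ f (fun z => z ^+ k)).
    exact: cf.
  exact: exprn_continuous.
have c1 := cu 1; have c2 := cu (- 1).
rewrite (_ : (fun x : R => _) = (fun x : R =>
  ((uphalf n)%:R * ((t + 1 * (x / c)) / 2) ^+ n./2 * ((t + - 1 * (x / c)) / 2) ^+ (uphalf n).-1
   - n./2%:R * ((t + 1 * (x / c)) / 2) ^+ n./2.-1 * ((t + - 1 * (x / c)) / 2) ^+ uphalf n) *
   ((2 * (n./2`!%:R * (uphalf n)`!%:R))^-1 / c))); last first.
  by apply/funext => x; rewrite /survival_slope/= mul1r mulN1r -mulrA.
move=> x; apply: cvgM; last exact: cvg_cst.
apply: cvgB; (apply: cvgM; last exact: (cX _ _ c2));
  (apply: cvgM; last exact: (cX _ _ c1)); exact: cvg_cst.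
Qed.

(** The coefficient vanishes at y = ct as soon as there is a jump; the index n = 0, excluded here,
    is the atom. *)
Lemma integral_survival_slope n x : 0 <= x -> x <= c * t ->
  (\int[lebesgue_measure]_(y in `[x, (c * t)%R]) (survival_slope n.+1 t (y / c) / c)%R%:E =
   (survival_coef n.+1 t (x / c)%R)%:E)%E.
Proof.
move=> x0; have ctc : c * t / c = t by rewrite mulrC mulKf// gt_eqF.
rewrite le_eqVlt => /predU1P[->|xct].
  by rewrite set_itv1 integral_set1 ctc survival_coef_diag.
have cF : continuous (fun y : R => - survival_coef n.+1 t (y / c)).
  move=> y; apply: differentiable_continuous; apply/derivable1_diffP.
  by have [] := is_derive_survival_coef n.+1 y.
rewrite (@continuous_FTC2 _ _ (fun y : R => - survival_coef n.+1 t (y / c)))//.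
- by rewrite ctc survival_coef_diag oppr0 -EFinB sub0r opprK.
- by apply: continuous_subspaceT; exact: continuous_survival_slope.
- split.
  + by move=> y _; have [] := is_derive_survival_coef n.+1 y.
  + by apply: cvg_at_right_filter; exact: cF.
  + by apply: cvg_at_left_filter; exact: cF.
- by move=> y _; rewrite derive1E; have [_ ->] := is_derive_survival_coef n.+1 y.
Qed.

(** At x = 0 both u and v are t/2, and the indices 2k and 2k + 1 give the k-th terms of I_0 and
    I_1. *)
Lemma survival_coef_series0 :
  (\sum_(n <oo) (lambda ^+ n * survival_coef n t 0)%R%:E =
   (bessel_I 0 (lambda * t) + bessel_I 1 (lambda * t))%R%:E)%E.
Proof.
have lt0 : 0 <= lambda * t by rewrite mulr_ge0// ltW.
apply: nneseries_pairs => [n|].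
  rewrite mulr_ge0 ?exprn_ge0 ?(ltW lambda_gt0)//.
  by rewrite /survival_coef addr0 subr0 divr_ge0 ?mulr_ge0 ?exprn_ge0 ?divr_ge0 ?(ltW t_gt0).
rewrite (_ : series _ = series (bessel_term 0 (lambda * t)) + series (bessel_term 1 (lambda * t))).
  by apply: cvgD; exact: cvg_bessel.
rewrite -seriesD; congr series; apply/funext => k.
rewrite /survival_coef /bessel_term doubleK -[k.*2.+1./2]/(uphalf k.*2) uphalf_double.
rewrite -[uphalf k.*2.+1]/(k.*2./2.+1) doubleK addr0 subr0.
rewrite -[RHS]/(_ / _ + _ / _) mul2n addn0 addn1 add0n add1n.
rewrite -(mulrA lambda) exprS [(lambda * (t / 2)) ^+ _.+1]exprS !exprMn -addnn !exprD exprS.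
by congr (_ + _); rewrite ?(exprS 2^-1); ring.
Qed.

Let Q0 := bessel_I 0 (lambda * t) + bessel_I 1 (lambda * t).

Lemma bessel_sum_gt0 : 0 < Q0.
Proof.
have lt0 : 0 <= lambda * t by rewrite mulr_ge0// ltW.
by rewrite ltr_wpDr ?bessel_ge0// (lt_le_trans ltr01)// bessel0_ge1.
Qed.

(** The shift by one leaves out the atom: [term n] is the contribution of n + 1 jumps. *)
Let term n x := lambda ^+ n.+1 * (survival_slope n.+1 t (x / c) / c).

Let term_ge0 n x : 0 <= x -> x <= c * t -> 0 <= term n x.
Proof.
move=> x0 xct; rewrite mulr_ge0 ?exprn_ge0 ?(ltW lambda_gt0)//.
rewrite divr_ge0 ?(ltW c_gt0)// survival_slope_ge0//.
by rewrite divr_ge0 ?(ltW c_gt0)//= ler_pdivrMr// mulrC.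
Qed.

(* With u = (t + x/c)/2 and v = (t - x/c)/2 the Bessel argument is
   2 lambda sqrt(u v), so both series run over powers of lambda^2 u v. *)
Lemma survival_slope_series x : 0 <= x < c * t ->
  series (fun k => term k.*2 x + term k.*2.+1 x) @ \oo -->
  Q0 * telegraph_meander_density lambda c t x.
Proof.
case/andP=> x0 xct.
have normalize (q a D : R) : 0 < q -> a = 1 -> q * (a / q * D) = D.
  by move=> q0 ->; field; rewrite gt_eqF.
rewrite /telegraph_meander_density normalize; last 2 first.
- exact: bessel_sum_gt0.
- by rewrite indicE mem_set//= in_itv/= x0.
set r := Num.sqrt _.
pose u := (t + x / c) / 2; pose v := (t - x / c) / 2.
have xc0 : 0 <= x / c by rewrite divr_ge0// ltW.
have xct' : x / c < t by rewrite ltr_pdivrMr// mulrC.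
have u0 : 0 < u by rewrite /u; lra.
have v0 : 0 < v by rewrite /v; lra.
have tE : t = u + v by rewrite /u /v; lra.
have c0 : c != 0 by rewrite gt_eqF.
have xE : x = c * (u - v) by rewrite /u /v; field.
have r2 : r ^+ 2 = 4 * c ^+ 2 * (u * v).
  rewrite sqr_sqrtr; first by rewrite [in LHS]xE [in LHS]tE; ring.
  by rewrite -exprMn subr_ge0 lerXn2r ?nnegrE ?mulr_ge0 ?(ltW c_gt0) ?(ltW t_gt0)// ltW.
have r0 : 0 < r.
  rewrite lt0r sqrtr_ge0 andbT -sqrf_eq0 r2 gt_eqF//.
  by apply: mulr_gt0; apply: mulr_gt0 => //; exact: exprn_gt0.
set z := lambda / c * r.
have z0 : 0 <= z by rewrite !mulr_ge0 ?invr_ge0 ?ltW.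
have z2 : (z / 2) ^+ 2 = lambda ^+ 2 * (u * v).
  rewrite /z !exprMn r2; field; exact: c0.
pose alpha := lambda * x / (c * (c * t + x)).
pose beta := (lambda * x / c + (c * t - x) / (c * t + x)) / r.
rewrite (_ : series _ = (fun n => alpha * series (bessel_term 0 z) n +
    beta * series (bessel_term 1 z) n)).
  have combine (i0 i1 : R) : lambda * x * i0 / (c * (c * t + x)) +
    i1 / r * (lambda * x / c + (c * t - x) / (c * t + x)) = alpha * i0 + beta * i1.
    by rewrite /alpha /beta; ring.
  rewrite combine.
  by apply: cvgD; (apply: cvgM; [exact: cvg_cst|exact: cvg_bessel]).
apply/funext => n; rewrite /series/= !mulr_sumr -big_split/=.
apply: eq_bigr => k _.
rewrite /bessel_term addn0 add0n add1n addn1 exprS exprM z2.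
(* The term with 2k + 2 jumps produces the part lambda x / c of [beta]. The one with 2k + 1 jumps
   splits by (k + 1) - k v/u = (k + 1)(1 - v/u) + v/u into the [alpha] term and the part v/u = (ct -
   x)/(ct + x) of [beta]. *)
rewrite /term /survival_slope -/u -/v.
rewrite -[k.*2.+1./2]/(uphalf k.*2) uphalf_double.
rewrite -[uphalf k.*2.+1]/(k.*2./2.+1) -[k.*2.+2./2]/(k.*2./2.+1) doubleK.
rewrite -[uphalf k.*2.+2]/((uphalf k.*2).+1) uphalf_double /=.
(* Trades the predecessor in the exponent for a division by u > 0; for k = 0 both sides are 0. *)
have pk : k%:R * u ^+ k.-1 = k%:R * u ^+ k / u.
  case: k => [|k]; first by rewrite !mul0r.
  by rewrite exprS/=; field; rewrite gt_eqF.
clearbody u v.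
rewrite pk (exprS lambda k.*2.+1) (exprS lambda k.*2) -mul2n exprM (exprS u k) (exprS v k).
rewrite !exprMn factS natrM -natr1.
have f0 : k`!%:R != 0 :> R by rewrite pnatr_eq0 -lt0n fact_gt0.
have k0 : k%:R + 1 != 0 :> R by rewrite natr1 pnatr_eq0.
have ctx : c * t + x = 2 * c * u by rewrite [in LHS]xE [in LHS]tE; ring.
have ctx' : c * t - x = 2 * c * v by rewrite [in LHS]xE [in LHS]tE; ring.
rewrite /alpha /beta ctx ctx' xE /z.
move: f0 k0 (lt0r_neq0 u0) (lt0r_neq0 r0).
set F := k`!%:R; set K := k%:R; set L := (lambda ^+ 2) ^+ k.
set U := u ^+ k; set V := v ^+ k => f0 k0 u0' r0'.
field; by rewrite c0 f0 k0 u0' r0'.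
Qed.

Lemma telegraph_meander_density_out x : ~~ (0 <= x < c * t) ->
  telegraph_meander_density lambda c t x = 0.
Proof.
move=> xout; rewrite /telegraph_meander_density indicE memNset ?mul0r//.
by rewrite /= in_itv/=; exact/negP.
Qed.

Lemma telegraph_meander_density_ge0 x : 0 <= telegraph_meander_density lambda c t x.
Proof.
have [xin|/telegraph_meander_density_out ->//] := boolP (0 <= x < c * t).
rewrite -(pmulr_rge0 _ bessel_sum_gt0).
have cv := survival_slope_series xin.
rewrite -(cvg_lim (@Rhausdorff R) cv); apply: limr_ge; first by apply/cvg_ex; eexists; exact: cv.
case/andP: xin => x0 /ltW xct.
by apply: nearW => n; apply: sumr_ge0 => k _; rewrite addr_ge0// term_ge0.
Qed.

Let density_cvg x : 0 <= x < c * t ->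
  (fun m => Q0^-1 * series (fun k => term k.*2 x + term k.*2.+1 x) m) @ \oo -->
  telegraph_meander_density lambda c t x.
Proof.
move=> /survival_slope_series cv.
rewrite -[telegraph_meander_density _ _ _ _](mulKf (lt0r_neq0 bessel_sum_gt0)).
by apply: cvgM; [exact: cvg_cst|exact: cv].
Qed.

(** Extension by zero makes the expansion of the density valid on the whole line, with measurable
    nonnegative terms. *)
Let gterm n (x : R) : R := if 0 <= x < c * t then Q0^-1 * term n x else 0.

Let measurable_gterm n : measurable_fun setT (gterm n).
Proof.
apply: measurable_fun_ifT => //.
  apply: measurable_and => //; [exact: measurable_fun_ler|exact: measurable_fun_ltr].
apply: continuous_measurable_fun => x; apply: cvgM; first exact: cvg_cst.
apply: cvgM; first exact: cvg_cst.
exact: continuous_survival_slope.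
Qed.

Lemma measurable_telegraph_meander_density :
  measurable_fun [set: R] (telegraph_meander_density lambda c t).
Proof.
apply: (@measurable_fun_cvg _ _ _ _ (fun (m : nat) (x : R) =>
  \sum_(0 <= k < m) (gterm k.*2 x + gterm k.*2.+1 x))).
  move=> m; apply: measurable_sum => k.
  by apply: measurable_funD; exact: measurable_gterm.
move=> x _; rewrite /gterm; case: (boolP (0 <= x < c * t)) => [xin|xout]; last first.
  rewrite telegraph_meander_density_out//.
  apply: cvg_near_cst; apply: nearW => m.
  by rewrite big1// => k _; rewrite addr0.
apply: cvg_trans (density_cvg xin); apply: near_eq_cvg; apply: nearW => m.
rewrite /series/= mulr_sumr; apply: eq_bigr => k _.
by rewrite mulrDr.
Qed.

Lemma telegraph_meander_density_series x :
  (telegraph_meander_density lambda c t x)%:E = (\sum_(n <oo) (gterm n x)%:E)%E.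
Proof.
rewrite /gterm; case: (boolP (0 <= x < c * t)) => [xin|xout]; last first.
  by rewrite telegraph_meander_density_out// eseries0.
case/andP: (xin) => x0 /ltW xct; have Q00 := bessel_sum_gt0.
apply/esym/nneseries_pairs => [n|].
  by rewrite mulr_ge0 ?invr_ge0 ?(ltW Q00)// term_ge0.
rewrite (_ : series _ = (fun m => Q0^-1 * series (fun k => term k.*2 x + term k.*2.+1 x) m)).
  exact: density_cvg.
apply/funext => m; rewrite /series/= mulr_sumr; apply: eq_bigr => k _.
by rewrite mulrDr.
Qed.

(** The nonnegative series is integrated term by term; each term lives on [0, ct[, so the half-line
    reduces to [max x 0, ct[. *)
Lemma integral_telegraph_meander_density_ge x : x <= c * t ->
  (\int[lebesgue_measure]_(y in `[x, +oo[) (telegraph_meander_density lambda c t y)%:E =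
   Q0^-1%:E * \sum_(n <oo) (lambda ^+ n.+1 *
      survival_coef n.+1 t (Num.max x 0 / c))%R%:E)%E.
Proof.
move=> xct; have Q00 := bessel_sum_gt0.
set y := Num.max x 0.
have y0 : 0 <= y by rewrite le_max lexx orbT.
have yct : y <= c * t by rewrite ge_max xct mulr_ge0// ltW.
under eq_integral do rewrite telegraph_meander_density_series.
have g0 n z : 0 <= gterm n z.
  rewrite /gterm; case: ifPn => // /andP[z0 /ltW zct].
  by rewrite mulr_ge0 ?invr_ge0 ?(ltW Q00)// term_ge0.
rewrite integral_nneseries//; last 2 first.
- by move=> n; apply/measurable_EFinP/measurable_funTS; exact: measurable_gterm.
- by move=> n z _; rewrite lee_fin.
have coef0 n : 0 <= survival_coef n.+1 t (y / c).
  have yc : 0 <= y / c by rewrite divr_ge0// ltW.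
  have yt : y / c <= t by rewrite ler_pdivrMr// mulrC.
  by rewrite /survival_coef divr_ge0// mulr_ge0// exprn_ge0// divr_ge0//; lra.
rewrite -nneseriesZl; last first.
  by move=> n _; rewrite lee_fin mulr_ge0 ?exprn_ge0// ltW.
apply: eq_eseriesr => n _.
rewrite -EFinM mulrA EFinM -integral_survival_slope//.
have itvE : `[x, +oo[%classic `&` `[0, (c * t)[%classic = `[y, (c * t)[%classic.
  apply/seteqP; split=> z /=; rewrite !in_itv/= ?andbT /y ge_max.
    by case=> -> /andP[-> ->].
  by move=> /andP[/andP[-> ->] ->].
have mslope : measurable_fun setT (fun z : R => survival_slope n.+1 t (z / c) / c).
  by apply: continuous_measurable_fun; exact: continuous_survival_slope.
rewrite -ge0_integralZl//; last 3 first.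
- by apply/measurable_EFinP/measurable_funTS.
- move=> z /=; rewrite in_itv/= => /andP[yz zct].
  rewrite lee_fin divr_ge0 ?(ltW c_gt0)// survival_slope_ge0//.
  by rewrite divr_ge0 ?(ltW c_gt0) ?(le_trans y0)//= ler_pdivrMr// mulrC.
- by rewrite lee_fin mulr_ge0 ?invr_ge0 ?(ltW Q00) ?exprn_ge0// ltW.
rewrite -integral_itv_bndo_bndc; last first.
  by apply: measurable_funeM; apply/measurable_EFinP/measurable_funTS.
rewrite -itvE integral_mkcondr; apply: eq_integral => z _.
rewrite patchE /gterm; case: ifPn => zin.
  by rewrite mem_set ?EFinM//=; rewrite -EFinM /term mulrA.
by rewrite memNset//= in_itv/=; exact/negP.
Qed.

Lemma integral_telegraph_meander_density_gt x : c * t <= x ->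
  (\int[lebesgue_measure]_(y in `[x, +oo[) (telegraph_meander_density lambda c t y)%:E = 0)%E.
Proof.
move=> ctx; apply: integral0_eq => y /=; rewrite in_itv/= andbT => xy.
by rewrite telegraph_meander_density_out// negb_and -leNgt (le_trans ctx xy) orbT.
Qed.

End meander_density.

(** * The law of the meander at time t *)

Section density_measure.
Context (R : realType).
Local Notation mu := (@lebesgue_measure R).

Definition density_measure (f : R -> R) (mf : measurable_fun setT f)
    (f0 : forall x, 0 <= f x) : set R -> \bar R :=
  fun A => (\int[mu]_(x in A) (f x)%:E)%E.

Variables (f : R -> R) (mf : measurable_fun setT f) (f0 : forall x, 0 <= f x).
Local Notation nu := (density_measure mf f0).

Let nu0 : nu set0 = 0%E. Proof. exact: integral_set0. Qed.

Let nu_ge0 A : (0 <= nu A)%E.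
Proof. by apply: integral_ge0 => x _; rewrite lee_fin. Qed.

Let nu_sigma_additive : semi_sigma_additive nu.
Proof.
move=> F mF tF mUF; rewrite /density_measure ge0_integral_bigcup//; last 2 first.
- by apply/measurable_EFinP; exact: measurable_funTS.
- by move=> x _; rewrite lee_fin.
by apply: is_cvg_nneseries => n _ _; exact: nu_ge0.
Qed.

HB.instance Definition _ := isMeasure.Build _ R _ nu nu0 nu_ge0 nu_sigma_additive.

Lemma density_measure_dominated : nu `<< mu.
Proof.
apply/null_content_dominatesP => A mA muA0; apply: null_set_integral => //.
by apply/measurable_EFinP; exact: measurable_funTS.
Qed.

End density_measure.

Section meander_law.
Context (R : realType) (lambda c t : R).
Hypotheses (lambda_gt0 : 0 < lambda) (c_gt0 : 0 < c) (t_gt0 : 0 < t).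
Context d (Omega : measurableType d) (P : probability Omega R).
Context (N : R -> {RV P >-> nat}) (V0 : {RV P >-> R}).
Hypothesis N_poisson : is_poisson_process lambda N.
Hypothesis V0_uniform : uniform_on_pm c V0.
Hypothesis V0_indep_N : independent_of_process V0 N.

Local Notation count := (fun s => N s : Omega -> nat).
Local Notation S w := (unit_telegraph (fun s => count s w)).
Local Notation generator := [set E | exists (s : R) (B : set nat),
  0 <= s /\ E = count s @^-1` B].

Let count_nd w (s u : R) : 0 <= s -> s <= u -> (N s w <= N u w)%N.
Proof. exact: (poisson_process_nondecreasing N_poisson). Qed.

Let count0 w : N 0 w = 0%N.
Proof. exact: (poisson_process_start N_poisson). Qed.

Lemma telegraphE w s : telegraph V0 count s w = V0 w * S w s.
Proof.
rewrite /telegraph /unit_telegraph /telegraph_velocity RintegralZl//.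
by apply: unit_telegraph_integrable => a b; exact: count_nd.
Qed.

Definition staying_above (y : R) : set Omega :=
  [set w | (forall r, 0 <= r <= t -> 0 <= S w r) /\ y <= S w t].

Let staying_aboveE y : staying_above y = \bigcup_n surviving N n t y.
Proof.
apply/seteqP; split=> [w [S0 Sy]|w [n _ [Nw S0 Sy]]] //.
by exists (N t w).
Qed.

Lemma process_staying_above y : process_sigma_algebra count (staying_above y).
Proof.
rewrite staying_aboveE.
apply: (@bigcupT_measurable _ (g_sigma_algebraType generator)) => n.
exact: (measurable_surviving N_poisson _ _ (ltW t_gt0)).
Qed.

Lemma measurable_staying_above y : measurable (staying_above y).
Proof.
apply: (process_sigma_algebra_measurable (N := N)).
exact: process_staying_above.
Qed.

Lemma staying_above_prob y : 0 <= y <= t ->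
  P (staying_above y) =
  ((expR (- (lambda * t)))%:E *
    \sum_(n <oo) (lambda ^+ n * survival_coef n t y)%R%:E)%E.
Proof.
move=> yt; rewrite staying_aboveE measure_bigcup//; last 2 first.
- move=> n _; apply: (process_sigma_algebra_measurable (N := N)).
  exact: (measurable_surviving N_poisson _ _ (ltW t_gt0)).
- by move=> m n _ _ [w [[<- _ _] [<- _ _]]].
case/andP: (yt) => y0 y_t.
rewrite -nneseriesZl; last first.
  move=> n _; rewrite lee_fin mulr_ge0 ?exprn_ge0 ?(ltW lambda_gt0)//.
  by rewrite /survival_coef divr_ge0// mulr_ge0// exprn_ge0// divr_ge0//; lra.
rewrite eseries_mkcond; apply: eq_eseriesr => n _; rewrite mem_set//.
exact: (surviving_prob lambda_gt0 N_poisson n yt).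
Qed.

Let nonneg_path (w : Omega) :=
  0 <= path_min t (fun s => telegraph V0 count s w).

(** The alternative [V0 w = 0], a null event, has to be kept because the equivalence is pathwise. *)
Lemma nonneg_pathP w : nonneg_path w <->
  (0 < V0 w /\ staying_above 0 w) \/ V0 w = 0.
Proof.
have t0 := ltW t_gt0.
have lip r : 0 <= r -> `|S w r| <= r.
  move=> r0; have := unit_telegraph_lipschitz (count_nd w) (lexx 0) r0.
  by rewrite unit_telegraph0 !subr0.
have -> : nonneg_path w <-> forall r, 0 <= r <= t -> 0 <= V0 w * S w r.
  rewrite /nonneg_path /path_min; split=> [m0 r rt|pos].
    apply: le_trans m0 _; rewrite -telegraphE.
    apply: ge_inf; last by exists r.
    (* This lower bound makes [inf] a genuine infimum and not a default value. *)
    exists (- (`|V0 w| * t)) => z [s /=]; rewrite in_itv/= => /andP[s0 st] <-.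
    rewrite telegraphE; apply: (@le_trans _ _ (- `|V0 w * S w s|)).
      rewrite lerN2 normrM ler_wpM2l//.
      exact: le_trans (lip s s0) st.
    by rewrite lerNl; rewrite -normrN; exact: ler_norm.
  apply: lb_le_inf.
    by exists (telegraph V0 count 0 w), 0 => //=; rewrite in_itv/= lexx.
  move=> z [s /=]; rewrite in_itv/= => st <-; rewrite telegraphE.
  exact: pos.
have [V|V|V] := ltrgtP 0 (V0 w).
- split=> [pos|[[_ [S0 _]]|V0w] r rt].
  + left; split => //; split=> [r rt|].
      by have := pos r rt; rewrite pmulr_rge0.
    by have := pos t; rewrite lexx t0 pmulr_rge0// => /(_ isT).
  + by rewrite mulr_ge0 ?(ltW V)// S0.
  + by rewrite V0w mul0r.
- split=> [pos|]; last by case=> [[]|V0w]; rewrite ?V0w; lra.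
  exfalso.
  (* Right continuity at 0 gives a short interval without jump, on which a negative initial velocity
     makes the path negative. *)
  have [e /= e0 He] := poisson_process_right_continuous N_poisson w (lexx 0).
  pose r := Num.min t (e / 2).
  have r0 : 0 < r by rewrite lt_min t_gt0 divr_gt0.
  have rt : r <= t by rewrite ge_min lexx.
  have re : r <= e / 2 by rewrite ge_min lexx orbT.
  have Nr : N r w = N 0 w.
    by apply: He => //=; rewrite sub0r normrN gtr0_norm//; lra.
  have Sr : S w r = r.
    rewrite (unit_telegraph_cst (count_nd w) (lexx 0) (ltW r0))//.
    by rewrite unit_telegraph0 count0 expr0 mul1r add0r subr0.
  have := pos r; rewrite (ltW r0) rt Sr => /(_ isT).
  by rewrite pmulr_lge0// leNgt V.
- split=> [_|_ r _]; first by right.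
  by rewrite -V mul0r.
Qed.

Let measurable_V0 B : measurable B -> measurable (V0 @^-1` B).
Proof. by move=> mB; rewrite -[X in measurable X]setTI; exact: measurable_funPT. Qed.

Let measurable_event x : measurable
  ([set w | x <= telegraph V0 count t w] `&` [set w | nonneg_path w]).
Proof.
apply: measurableI.
  have mS : measurable_fun [set: Omega] (fun w => S w t).
    move=> _ B mB; apply: (process_sigma_algebra_measurable (N := N)).
    exact: (measurable_unit_telegraph N_poisson (ltW t_gt0)).
  have mT : measurable_fun [set: Omega] (fun w => V0 w * S w t).
    by apply: measurable_funM => //; exact: measurable_funPT.
  have := mT measurableT `[x, +oo[%classic (measurable_itv _).
  rewrite setTI; congr (measurable _); apply/seteqP.
  by split=> w /=; rewrite in_itv/= andbT telegraphE.
have -> : [set w | nonneg_path w] =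
    (V0 @^-1` `]0, +oo[%classic `&` staying_above 0) `|` V0 @^-1` [set 0].
  apply/seteqP; split=> w.
    move/nonneg_pathP => [[V S0]|V]; [left|right] => //.
    by split => //=; rewrite in_itv/= andbT.
  move=> wV; apply/nonneg_pathP; case: wV => [[/=]|/= V]; last by right.
  by rewrite in_itv/= andbT => V S0; left.
apply: measurableU; last exact: measurable_V0.
by apply: measurableI; [exact: measurable_V0|exact: measurable_staying_above].
Qed.

(** Up to a null event only V0 = c survives; on it the telegraph path is c times the unit one, and
    independence of [V0] gives the factor 1/2. Survival already forces a final height >= 0, hence
    [Num.max x 0]. *)
Lemma nonneg_path_prob x :
  P ([set w | x <= telegraph V0 count t w] `&` [set w | nonneg_path w]) =
  (2^-1%:E * P (staying_above (Num.max x 0 / c)%R))%E.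
Proof.
set E := (X in P X); have mE : measurable E by exact: measurable_event.
set y := Num.max x 0 / c.
have [Vc VNc] := V0_uniform.
have mK z : measurable (V0 @^-1` [set z]) by exact: measurable_V0.
(* The two masses add up to 1, so all other values of [V0] form a null event. *)
pose KK := V0 @^-1` [set c] `|` V0 @^-1` [set - c].
have mKK : measurable KK by exact: measurableU.
have PKK : P KK = 1%E.
  rewrite /KK measureU//; last first.
    by apply/seteqP; split=> // w [/= ->] => e; move: c_gt0; lra.
  rewrite [X in (X + _)%E]Vc [X in (_ + X)%E]VNc -EFinD.
  by congr EFin; rewrite -[2^-1]div1r -splitr.
have EK : E `&` V0 @^-1` [set c] = V0 @^-1` [set c] `&` staying_above y.
  apply/seteqP; split=> w.
    move=> [[/= xT /nonneg_pathP npw] Vw]; rewrite telegraphE Vw in xT.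
    rewrite Vw in npw; case: npw => [[_ [S0 St]]|]; last by move: c_gt0; lra.
    split => //; split => //; rewrite /y ler_pdivrMr// ge_max mulrC xT/=.
    by rewrite mulr_ge0// ltW.
  move=> [/= Vw [S0 yS]]; split => //.
  move: yS; rewrite /y ler_pdivrMr// ge_max => /andP[xS _].
  split; first by rewrite /= telegraphE Vw mulrC.
  apply/nonneg_pathP; left; rewrite Vw; split => //; split => //.
  by apply: S0; rewrite (ltW t_gt0) lexx.
have P0 : P (E `&` ~` (V0 @^-1` [set c])) = 0%E.
  apply/eqP; rewrite eq_le measure_ge0 andbT.
  have -> : (0 = P (~` KK))%E.
    by rewrite probability_setC// [X in (1 - X)%E]PKK subee.
  apply: le_measure; rewrite ?inE.
  - by apply: measurableI => //; exact: measurableC.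
  - exact: measurableC.
  - move=> w [[_ /nonneg_pathP npw] Vw]; rewrite /KK setCU; split => //= VN.
    by move: npw; rewrite VN => -[[]|]; move: c_gt0; lra.
rewrite (measureDI P mE (mK c)) setDE [X in (X + _)%E]P0 add0e EK.
apply: etrans (V0_indep_N (measurable_set1 c) (process_staying_above y)) _.
by congr (_ * _)%E.
Qed.

(** Isolates the index 0, equal to 1, which becomes the atom; the rest will match the integral of
    the density. *)
Lemma staying_above_prob_split y : 0 <= y <= t ->
  exists s : R,
    (\sum_(n <oo) (lambda ^+ n.+1 * survival_coef n.+1 t y)%R%:E = s%:E)%E /\
    P (staying_above y) = (expR (- (lambda * t)) * (1 + s))%:E.
Proof.
move=> yt; have := staying_above_prob yt; case/andP: (yt) => y0 y_t.
have f0 n : 0 <= lambda ^+ n * survival_coef n t y.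
  rewrite mulr_ge0 ?exprn_ge0 ?(ltW lambda_gt0)//.
  by rewrite /survival_coef divr_ge0// mulr_ge0// exprn_ge0// divr_ge0//; lra.
have f00 : lambda ^+ 0 * survival_coef 0 t y = 1.
  by rewrite /survival_coef/= !expr0 !mul1r invr1.
rewrite nneseries_recl//; last by move=> n _; rewrite lee_fin.
rewrite -(@nneseries_addn _ (fun n => (lambda ^+ n * survival_coef n t y)%:E) 1); last first.
  by move=> n; rewrite lee_fin.
under eq_eseriesr do rewrite addn1.
set T := (\sum_(n <oo) _)%E; rewrite f00.
have T0 : (0 <= T)%E by apply: nneseries_ge0 => n _ _; rewrite lee_fin.
have fin : P (staying_above y) \is a fin_num.
  by rewrite fin_num_measure//; exact: measurable_staying_above.
(* An infinite sum would contradict the finiteness of the probability. *)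
case: T T0 => [s _ ->|_ PE|//]; first by exists s.
by move: fin; rewrite PE addey// mulr_infty gtr0_sg ?expR_gt0// mul1e.
Qed.

Local Notation Q0 := (bessel_I 0 (lambda * t) + bessel_I 1 (lambda * t)).

Lemma staying_above0_prob :
  P (staying_above 0) = (expR (- (lambda * t)) * Q0)%:E.
Proof.
rewrite staying_above_prob ?lexx ?(ltW t_gt0)//.
by rewrite (survival_coef_series0 lambda_gt0 t_gt0) EFinM.
Qed.

Lemma staying_above_gt y : t < y -> staying_above y = set0.
Proof.
move=> ty; apply/seteqP; split=> // w [_]; rewrite leNgt => /negP; apply.
apply: le_lt_trans ty.
have := unit_telegraph_lipschitz (count_nd w) (lexx 0) (ltW t_gt0).
by rewrite unit_telegraph0 !subr0 => /(le_trans (ler_norm _)).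
Qed.

(** The conditioning event is the joint event at level 0, so one formula serves numerator and
    denominator and the factor 1/2 cancels. *)
Lemma cond_prob_telegraph_ge x :
  cond_prob P [set w | x <= telegraph V0 count t w] [set w | nonneg_path w] =
  (fine (P (staying_above (Num.max x 0 / c))) / (expR (- (lambda * t)) * Q0))%:E.
Proof.
have -> : [set w | nonneg_path w] =
    [set w | 0 <= telegraph V0 count t w] `&` [set w | nonneg_path w].
  apply/seteqP; split=> w; last by case.
  move=> wV; split => //=; move/nonneg_pathP: wV; rewrite telegraphE.
  by case=> [[V [_ S0]]|->]; rewrite ?mul0r// mulr_ge0// ltW.
rewrite /cond_prob setIA [X in fine (P X) / _](_ : _ =
    [set w | Num.max x 0 <= telegraph V0 count t w] `&` [set w | nonneg_path w]); last first.
  apply/seteqP; split=> w [/=]; first by case=> xT T0 wV; rewrite ge_max xT.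
  by rewrite ge_max => /andP[xT T0].
rewrite !nonneg_path_prob maxxx mul0r staying_above0_prob -maxA maxxx.
have fin y : P (staying_above y) \is a fin_num.
  by rewrite fin_num_measure//; exact: measurable_staying_above.
rewrite !fineM//= invfM mulrACA divff ?mul1r//.
Qed.

Lemma meander_density_law d' (Omega' : measurableType d')
    (P' : probability Omega' R) (Y : {RV P' >-> R}) :
  (forall x, P' (Y @^-1` `[x, +oo[%classic) =
     cond_prob P [set w | x <= telegraph V0 count t w] [set w | nonneg_path w]) ->
  ac_component_density (distribution P' Y) (telegraph_meander_density lambda c t).
Proof.
move=> law.
have mf := measurable_telegraph_meander_density lambda_gt0 c_gt0 t_gt0.
have f0 := telegraph_meander_density_ge0 lambda_gt0 c_gt0 t_gt0.
have Q00 := bessel_sum_gt0 lambda_gt0 t_gt0.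
split => //.
have Q0i : 0 <= Q0^-1 by rewrite invr_ge0 ltW.
pose mu_ac : {measure set R -> \bar R} := density_measure mf f0.
(* Without jump the path ends at ct; the conditional mass is e^(-lambda t) divided by e^(-lambda t)
   times the Bessel sum. *)
pose mu_s : {measure set R -> \bar R} := mscale (NngNum Q0i) \d_(c * t).
have mu_sE B : mu_s B = (Q0^-1 * \1_B (c * t))%:E by [].
exists mu_ac, mu_s; split => //; split.
- exact: density_measure_dominated.
- exists (~` [set c * t]); first exact: measurableC.
  rewrite setCK; split; last exact: lebesgue_measure_set1.
  by rewrite mu_sE indicE memNset ?mulr0// => /(_ erefl).
move=> A mA; rewrite -measure_addE.
(* The half-lines [x, +oo[ form a generating pi-system, and those with x = -k exhaust the line with
   finite measure. *)
apply: (@measure_unique _ _ _ (@RGenCInfty.G R) (fun k => `[(- k%:R), +oo[%classic)) => //.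
- exact: RGenCInfty.measurableE.
- move=> _ _ [x ->] [y ->]; exists (Num.max x y); apply/seteqP.
  split=> z /=; rewrite !in_itv/= !andbT ge_max; first by case=> -> ->.
  by case/andP.
- by move=> k; exists (- k%:R).
- apply/seteqP; split=> // x _; exists (Num.truncn `|x|).+1 => //=.
  rewrite in_itv/= andbT lerNl; apply: le_trans (ltW (truncnS_gt _)).
  by rewrite -normrN ler_norm.
- move=> _ [x ->]; apply: etrans _ (esym (measure_addE mu_ac mu_s _)).
  rewrite [LHS]law cond_prob_telegraph_ge mu_sE indicE /mu_ac /= /density_measure.
  have [xct|ctx] := leP x (c * t); last first.
    rewrite (integral_telegraph_meander_density_gt _ (ltW ctx)) staying_above_gt; last first.
      by rewrite ltr_pdivlMr// mulrC lt_max ctx.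
    rewrite measure0 mul0r memNset ?mulr0 ?adde0//=.
    by rewrite in_itv/= andbT leNgt ctx.
  rewrite (integral_telegraph_meander_density_ge lambda_gt0 c_gt0 t_gt0 xct).
  have yt : 0 <= Num.max x 0 / c <= t.
    rewrite divr_ge0 ?(ltW c_gt0) ?le_max ?lexx ?orbT//= ler_pdivrMr// mulrC.
    by rewrite ge_max xct mulr_ge0// ltW.
  have [s [-> ->]] := staying_above_prob_split yt.
  rewrite mem_set; last by rewrite /= in_itv/= xct.
  rewrite mulr1 -EFinM -EFinD /=; congr EFin.
  have e0 := expR_gt0 (- (lambda * t)).
  move: Q00; set q := bessel_I _ _ + _ => q0.
  by field; rewrite !gt_eqF.
- by move=> k; rewrite (le_lt_trans (probability_le1 _ _)) ?ltry.
Qed.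

End meander_law.

Theorem mainTheorem2 (R : realType) (lambda c t : R)
    (lambda_gt0 : 0 < lambda) (c_gt0 : 0 < c) (t_gt0 : 0 < t)
    (d : measure_display) (Omega : measurableType d) (P : probability Omega R)
    (N : R -> {RV P >-> nat}) (V0 : {RV P >-> R})
    (N_poisson : is_poisson_process lambda N)
    (V0_uniform : uniform_on_pm c V0)
    (V0_indep_N : independent_of_process V0 N)
    (d' : measure_display) (Omega' : measurableType d')
    (P' : probability Omega' R) (X : R -> {RV P' >-> R})
    (X_meander : is_telegraph_meander V0 N t X) :
  ac_component_density (distribution P' (X t))
    (telegraph_meander_density lambda c t).
Proof.
apply: (meander_density_law lambda_gt0 c_gt0 t_gt0 N_poisson V0_uniform V0_indep_N).
move=> x.
have mF : path_sigma_algebra t [set f : R -> R | `[x, +oo[%classic (f t)].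
  apply: sub_sigma_algebra; exists t, `[x, +oo[%classic; split => //.
  exact: ltW.
rewrite [LHS](meander_law X_meander mF); congr (cond_prob _ _ _).
by apply/seteqP; split=> w /=; rewrite in_itv/= andbT.
Qed.
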